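(* Let $X$ be a separable Banach space, $Y$ a Banach space with the Radon-Nikodým property, $G \subset X$ an open set, and $f:G \to Y$ a pointwise Lipschitz mapping. Then $f$ is Hadamard differentiable at all points of $G$ except a set belonging to $\tilde{\mathcal{A}}$; that is, there exists $A\in\tilde{\mathcal{A}}$ such that $f$ is Hadamard differentiable at each $x\in G\setminus A$.
   Context: Banach spaces are real. Let $X,Y$ be Banach spaces, $G\subset X$ open, $f:G\to Y$, $x\in G$. $f$ is Lipschitz at $x$ if $\limsup_{y\to x}\frac{\|f(y)-f(x)\|}{\|y-x\|}<\infty$; $f$ is pointwise Lipschitz if it is Lipschitz at every point of $G$. $f$ is Hadamard differentiable at $x$ if there is a continuous linear operator $L:X\to Y$ such that $\lim_{t\to 0}\frac{f(x+tv)-f(x)}{t}=L(v)$ for each $v\in X$ and, for every compact set $C\subset X$, the limit is uniform with respect to $v\in C$. The system $\tilde{\mathcal{A}}$ of subsets of a separable Banach space $X$ (Preiss–Zajíček): for $0\neq v\in X$ and $\varepsilon>0$, let $\tilde{\mathcal{A}}(v,\varepsilon)$ be the system of all Borel sets $B\subset X$ such that $\{t\in\mathbb{R}:\varphi(t)\in B\}$ is Lebesgue null whenever $\varphi:\mathbb{R}\to X$ is such that the mapping $t\mapsto\varphi(t)-tv$ is Lipschitz with constant at most $\varepsilon$. For $0\ne v\in X$, let $\tilde{\mathcal{A}}(v)$ be the system of all sets $B=\bigcup_{k=1}^\infty B_k$ with $B_k\in\tilde{\mathcal{A}}(v,\varepsilon_k)$ for some $\varepsilon_k>0$. Finally, $\tilde{\mathcal{A}}$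 is the system of all $B\subset X$ such that for every sequence $(v_n)_{n=1}^\infty$ of nonzero vectors whose linear span is dense in $X$, $B$ can be written as $B=\bigcup_{n=1}^\infty B_n$ with $B_n\in\tilde{\mathcal{A}}(v_n)$ for each $n$. *)

(* Defs.v *)
From HB Require Import structures.
From mathcomp Require Export all_boot all_order all_algebra.
From mathcomp Require Export all_classical all_reals all_analysis.
Set Implicit Arguments.
Unset Strict Implicit.
Unset Printing Implicit Defensive.
Import Order.TTheory GRing.Theory Num.Theory.
Export numFieldNormedType.Exports.
Local Open Scope classical_set_scope.
Local Open Scope ring_scope.

Definition separable (T : topologicalType) : Prop :=
  exists2 D : set T, countable D & dense D.

Definition linear_span (R : realType) (X : normedModType R) (v : nat -> X)
    : set X :=
  [set x | exists n (c : nat -> R), x = \sum_(i < n) c i *: v i].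

(** * Differentiability

Maps G -> Y with G open are represented by total maps X -> Y. The two notions
below are local, so at points of G they do not depend on the values taken
outside G. *)

(* If X is trivial, x^' is the trivial filter and the limsup is -oo. *)
Definition lipschitz_at (R : realType) (X Y : normedModType R)
    (f : X -> Y) (x : X) : Prop :=
  (limf_esup (fun y => (`|f y - f x| / `|y - x|)%:E) x^' < +oo)%E.

Definition pointwise_lipschitz (R : realType) (X Y : normedModType R)
    (G : set X) (f : X -> Y) : Prop :=
  forall x, G x -> lipschitz_at f x.

Definition hadamard_differentiable (R : realType) (X Y : normedModType R)
    (f : X -> Y) (x : X) : Prop :=
  exists L : {linear X -> Y},
    let q (t : R) (v : X) : Y := t^-1 *: (f (x + t *: v) - f x) in
    [/\ continuous L,
        forall v : X, q t v @[t --> (0 : R)^'] --> L v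
      & forall C : set X, compact C ->
          {uniform C, q t @[t --> (0 : R)^'] --> (L : X -> Y)}].

(** * The system of exceptional sets of Preiss and Zajicek *)

Definition tildeA_veps (R : realType) (X : normedModType R)
    (v : X) (eps : R) : set (set X) :=
  [set B | <<s open >> B /\
    forall phi : R -> X, eps.-lipschitz (fun t : R^o => phi t - t *: v) ->
      (@lebesgue_measure R).-negligible (phi @^-1` B)].

Definition tildeA_v (R : realType) (X : normedModType R) (v : X)
    : set (set X) :=
  [set B | exists (Bk : nat -> set X) (eps : nat -> R),
    (forall k, 0 < eps k /\ tildeA_veps v (eps k) (Bk k)) /\
    B = \bigcup_k Bk k].

Definition tildeA (R : realType) (X : normedModType R) : set (set X) :=
  [set B | forall v : nat -> X,
    (forall n, v n != 0) -> dense (linear_span v) ->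
    exists2 Bn : nat -> set X,
      (forall n, tildeA_v (v n) (Bn n)) & B = \bigcup_n Bn n].

(** * Bochner integral and the Radon-Nikodym property

The definition of the Radon-Nikodym property is the measure-theoretic one:
every vector measure of bounded variation that is absolutely continuous with
respect to a finite measure has a Bochner integrable density. *)

Section bochner.
Context (d : measure_display) (T : measurableType d) (R : realType)
  (Y : completeNormedModType R).
Implicit Types (mu : {finite_measure set T -> \bar R}) (m : set T -> Y).

Definition simple_function (s : T -> Y) : Prop :=
  finite_set (range s) /\ forall y, measurable (s @^-1` [set y]).

Definition simple_integral mu (E : set T) (s : T -> Y) : Y :=
  \sum_(y \in range s) fine (mu (E `&` s @^-1` [set y])) *: y.

(* Convergence is required everywhere rather than almost everywhere. This makes
   `|s n - g| measurable in [L1_approximation] for simple [s n], also when mu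
   is not complete, and every almost everywhere limit of simple functions is
   equal almost everywhere to such a g. *)
Definition strongly_measurable (g : T -> Y) : Prop :=
  exists2 s : nat -> T -> Y, forall n, simple_function (s n)
    & forall x, s n x @[n --> \oo] --> g x.

Definition L1_approximation mu (s : nat -> T -> Y) (g : T -> Y) : Prop :=
  (forall n, simple_function (s n)) /\
  (\int[mu]_x (`|s n x - g x|)%:E @[n --> \oo] --> 0)%E.

Definition bochner_integrable mu (g : T -> Y) : Prop :=
  strongly_measurable g /\ exists s, L1_approximation mu s g.

(* For a Bochner integrable g the limit does not depend on s. *)
Definition is_bochner_integral mu (E : set T) (g : T -> Y) (I : Y) : Prop :=
  bochner_integrable mu g /\
  exists2 s, L1_approximation mu s g
    & simple_integral mu E (s n) @[n --> \oo] --> I.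

Definition vector_measure m : Prop :=
  forall F : nat -> set T,
    (forall k, measurable (F k)) -> trivIset setT F ->
    \sum_(k < n) m (F k) @[n --> \oo] --> m (\bigcup_k F k).

Definition bounded_variation_measure m : Prop :=
  exists M : R, forall (n : nat) (F : nat -> set T),
    (forall k, measurable (F k)) -> trivIset setT F ->
    \sum_(k < n) `|m (F k)| <= M.

Definition absolutely_continuous m mu : Prop :=
  forall eps : R, 0 < eps -> exists2 delta : R, 0 < delta &
    forall E, measurable E -> (mu E < delta%:E)%E -> `|m E| < eps.

End bochner.

Definition radon_nikodym_property (R : realType)
    (Y : completeNormedModType R) : Prop :=
  forall (d : measure_display) (T : measurableType d)
    (mu : {finite_measure set T -> \bar R}) (m : set T -> Y),
    vector_measure m -> bounded_variation_measure m ->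
    absolutely_continuous m mu ->
    exists g : T -> Y,
      forall E, measurable E -> is_bochner_integral mu E g (m E).

(* Main.v *)
Require Import Defs.
From HB Require Import structures.
From mathcomp Require Import measurable_realfun ring lra.
Import Order.TTheory GRing.Theory Num.Theory.
Set Implicit Arguments.
Unset Strict Implicit.
Unset Printing Implicit Defensive.
Local Open Scope classical_set_scope.
Local Open Scope ring_scope.

(** Why the theorem holds.

Call [E = lipset f G r M] the set of the points [x] such that
[`|f y - f x| <= M * `|y - x|] whenever [`|y - x| < r]. These sets are closed,
and countably many of them cover [G]. The increment of [f] between two points is
under control only if one of them is in [E], so a point [x + t *: u] near [x] has
to be replaced by a point of [E] close to it.
This is possible, with an error of order [c * `|t|], unless [E] is porous at [x]
in the direction [u], that is, unless it has arbitrarily small holes there of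
radius proportional to their distance from [x].

Two facts about curves provide the elements of the system attached to one
direction [v]. Let [phi t - t *: v] be Lipschitz with a small constant.
- If [E] is porous at [phi t] in the direction [v], the closed set
  [phi @^-1` E] has proportional gaps near [t], so [t] is not one of its density
  points (lemma [porous_tildeA_veps]).
- On [phi @^-1` E], cut into small pieces, [f \o phi] is Lipschitz. Extended
  affinely over the gaps it becomes a Lipschitz curve on the line, whose
  increments define a vector measure dominated by Lebesgue measure (lemma
  [lipschitz_measure]). The Radon-Nikodym property gives this measure a density,
  which is nearly constant on each of countably many pieces; at density points
  of these pieces the curve is differentiable up to a small error. As
  [phi (t + s)] and [phi t + s *: v] differ by a small multiple of [s], [f] is
  differentiable at [phi t] in the direction [v], up to a small error (lemma
  [negligible_not_almost_diff]).

Given a sequence [v] with dense span, let [tildeA_ideal v] consist of the sets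
covered by countably many of the null sets attached to the [v n]. The directions
[u] such that all sets of points of porosity in the direction [u] are in the
ideal are stable under scaling, sums and limits, hence exhaust the space (lemma
[porous_ideal]). The same holds for the sets where [f] has no derivative in the
direction [u] up to a given error (lemma [nondiff_ideal]). For sums, one goes
from [x] to [x + t *: u1] and then to [x + t *: (u1 + u2)]. The middle point has
to be one from which the second step behaves well at the scale [t], which is not
small for that point; this is why porosity is applied to the sets where the
behaviour in the direction [u2] is uniform up to a fixed scale, and not only to
[E].

Finally, the exceptional set is built from one dense sequence of directions, so
that it does not depend on [v]; it is Borel and belongs to the ideal of every
[v]. At the other points of [E], [f] has a derivative in every direction,
additive and Lipschitz in the direction, and its difference quotients are
asymptotically Lipschitz in the direction. The latter makes the convergence
locally uniform, hence uniform on compact sets. *)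

(** * Preliminaries *)

Lemma inv_small (R : realType) (d : R) : 0 < d -> exists j : nat, j.+1%:R^-1 < d.
Proof.
by move=> d0; have [j _ jd] := near_infty_natSinv_lt (PosNum d0);
  exists j; apply: jd => /=.
Qed.

Lemma small_multiple (R : realType) (K eta : R) : 0 <= K -> 0 < eta ->
  exists2 c, 0 < c <= 1 & K * c <= eta.
Proof.
move=> K0 eta0; have K1 : 0 < K + 1 by rewrite ltr_wpDl.
exists (Num.min 1 (eta / (K + 1))).
  by rewrite lt_min ltr01 ge_min lexx andbT divr_gt0.
apply: (@le_trans _ _ (K * (eta / (K + 1)))).
  by apply: ler_wpM2l => //; rewrite ge_min lexx orbT.
by rewrite mulrCA ler_piMr ?(ltW eta0)// ler_pdivrMr// mul1r lerDl.
Qed.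

Lemma countable_enum (T : choiceType) (D : set T) : countable D -> D !=set0 ->
  exists e : nat -> T, range e = D.
Proof.
move=> /countable_injP[f injf] [x0 Dx0].
have /choice[e he] : forall n : nat, exists x, D x /\
    ((exists2 y, D y & f y = n) -> f x = n).
  move=> n; have [[y Dy fy]|h] := pselect (exists2 y, D y & f y = n).
    by exists y; split.
  by exists x0; split.
exists e; apply/seteqP; split=> [_ [n _ <-]|x Dx]; first by have [] := he n.
have [De fe] := he (f x); exists (f x) => //.
by apply: injf; rewrite ?inE//; apply: fe; exists x.
Qed.

Section separability.
Context (R : realType) (X : normedModType R).

Lemma separable_seq : separable X -> exists e : nat -> X, dense (range e).
Proof.
move=> [D cD dD]; have D0 : D !=set0.
  by have [|x [_ Dx]] := dD setT _ openT; [exists 0|exists x].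
by have [e eD] := countable_enum cD D0; exists e; rewrite eD.
Qed.

Lemma dense_near (e : nat -> X) (x : X) (d : R) : dense (range e) -> 0 < d ->
  exists i, `|e i - x| < d.
Proof.
move=> edense d0; have [|y [xy [i _ iy]]] := edense _ _ (ball_open x d).
  by exists x; exact: ballxx.
by exists i; move: xy; rewrite -ball_normE /= -iy distrC.
Qed.

End separability.

(** * Directional porosity *)

Section porosity.
Context (R : realType) (X : normedModType R).
Implicit Types (E : set X) (u x y : X) (c d t : R).

(** The strict inequality [c < c'] makes this set closed when [E] is. *)
Definition nonporous E u c d : set X := [set x | E x /\
  forall t c', 0 < `|t| < d -> c < c' ->
    exists2 y, E y & `|x + t *: u - y| <= c' * `|t|].

Definition porous E u c : set X :=
  E `\` \bigcup_(j : nat) nonporous E u c j.+1%:R^-1.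

Lemma nonporousW E u c d d' : d' <= d ->
  nonporous E u c d `<=` nonporous E u c d'.
Proof.
move=> d'd x [Ex h]; split=> // t c' /andP[t0 td] cc'.
by apply: h => //; rewrite t0 (lt_le_trans td).
Qed.

Lemma porousP E u c x : porous E u c x <->
  E x /\ forall d, 0 < d -> ~ nonporous E u c d x.
Proof.
split=> [[Ex nE]|[Ex nE]]; split=> //.
- move=> d d0 xd; apply: nE; have [j jd] := inv_small d0.
  by exists j => //; apply: nonporousW xd; exact: ltW.
- by move=> [j _ xj]; apply: (nE _ _ xj); rewrite invr_gt0 ltr0n.
Qed.

Lemma not_porous E u c x : E x -> ~ porous E u c x ->
  exists2 d, 0 < d & nonporous E u c d x.
Proof.
move=> Ex np; apply: contrapT => h; apply: np; apply/porousP; split=> // d d0 xd.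
by apply: h; exists d.
Qed.

Lemma closed_nonporous E u c d : closed E -> closed (nonporous E u c d).
Proof.
move=> cE x clx; split.
  by apply: cE; apply: closure_subset clx => y [].
move=> t c' td cc'; have /andP[t0 _] := td.
have e0 : 0 < (c' - c) / 2 * `|t| by rewrite !mulr_gt0 ?invr_gt0 ?subr_gt0.
have [y [[Ey hy] /= xy]] := clx _ (nbhsx_ballx x _ e0).
have cc2 : c < (c + c') / 2 by lra.
have [z Ez hz] := hy t _ td cc2.
exists z => //; move: xy; rewrite -ball_normE /= => xy.
have -> : x + t *: u - z = (x - y) + (y + t *: u - z).
  by rewrite [RHS]addrA subrKA.
apply: le_trans (ler_normD _ _) _; apply: le_trans (lerD (ltW xy) hz) _.
by rewrite -mulrDl; apply: ler_wpM2r => //; lra.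
Qed.

(** A point of [E] near [x + t *: (u1 + u2)] is reached in two steps, the
intermediate point being taken in the set of those points of [E] at which [E]
is uniformly nonporous in the direction [u2]. *)
Lemma porous_add E u1 u2 c : 0 < c ->
  porous E (u1 + u2) c `<=` porous E u2 (c / 4) `|`
    \bigcup_j porous (nonporous E u2 (c / 4) j.+1%:R^-1) u1 (c / 4).
Proof.
move=> c0 x /porousP[Ex px]; have [|/(not_porous Ex)[d d0 xd]] :=
  pselect (porous E u2 (c / 4) x); first by left.
right; have [j jd] := inv_small d0; exists j => //.
have xj : nonporous E u2 (c / 4) j.+1%:R^-1 x by apply: nonporousW xd; exact: ltW.
apply: contrapT => /(not_porous xj)[e e0 [_ xe]].
have j0 : (0 : R) < j.+1%:R^-1 by rewrite invr_gt0 ltr0n.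
apply: (px (Num.min e j.+1%:R^-1)); first by rewrite lt_min e0.
split=> // t c' /andP[t0]; rewrite lt_min => /andP[te tj] cc'.
have c42 : c / 4 < c / 2 by lra.
have [|y [Ey hy] xy] := xe t (c / 2) _ c42; first by rewrite t0.
have [|z Ez yz] := hy t (c / 2) _ c42; first by rewrite t0.
exists z => //.
have -> : x + t *: (u1 + u2) - z = (x + t *: u1 - y) + (y + t *: u2 - z).
  by rewrite scalerDr addrA [RHS]addrA subrKA.
apply: le_trans (ler_normD _ _) _; apply: le_trans (lerD xy yz) _.
by rewrite -mulrDl; apply: ler_wpM2r => //; lra.
Qed.

Lemma porous_scale E u s c : s != 0 ->
  porous E (s *: u) c `<=` porous E u (c / `|s|).
Proof.
move=> s0 x /porousP[Ex px]; apply/porousP; split=> // d d0 [_ xd].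
have ns0 : 0 < `|s| by rewrite normr_gt0.
apply: (px (d / `|s|)); first by rewrite divr_gt0.
split=> // t c' /andP[t0 td] cc'.
have [||y Ey xy] := xd (t * s) (c' / `|s|).
- by rewrite normrM mulr_gt0//= -ltr_pdivlMr.
- by rewrite ltr_pM2r ?invr_gt0.
exists y => //; move: xy; rewrite -scalerA normrM.
by have -> // : c' / `|s| * (`|t| * `|s|) = c' * `|t| by field; rewrite gt_eqF.
Qed.

Lemma porous_approx E u u' c : 0 < c -> `|u - u'| <= c / 2 ->
  porous E u c `<=` porous E u' (c / 2).
Proof.
move=> c0 uu' x /porousP[Ex px]; apply/porousP; split=> // d d0 [_ xd].
apply: (px d) => //; split=> // t c' td cc'.
have [|y Ey xy] := xd t (c' - c / 2) td; first by lra.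
exists y => //.
have -> : x + t *: u - y = (x + t *: u' - y) + t *: (u - u').
  by rewrite scalerBr [x + t *: u' - y]addrAC -[RHS]addrA [t *: u' + _]addrC
    subrK addrAC.
apply: le_trans (ler_normD _ _) _; rewrite normrZ [`|t| * _]mulrC.
have -> : c' * `|t| = (c' - c / 2) * `|t| + c / 2 * `|t| by ring.
by apply: lerD => //; exact: ler_wpM2r.
Qed.

Lemma porous0 E c : 0 < c -> porous E 0 c = set0.
Proof.
move=> c0; apply/seteqP; split=> // x /porousP[Ex px].
apply: (px 1) => //; split=> // t c' td cc'; exists x => //.
by rewrite scaler0 addr0 subrr normr0 mulr_ge0//; lra.
Qed.

End porosity.

(** * The ideal of a sequence of directions *)

Section ideal.
Context (R : realType) (X : normedModType R).
Implicit Types (v : nat -> X) (S : set X).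

(** All subsets of the covering sets are included: measurability then matters
only for the covering sets. *)
Definition tildeA_ideal v : set (set X) := [set S |
  exists B : nat -> set X,
    (forall k, exists n e, 0 < e /\ tildeA_veps (v n) e (B k)) /\
    S `<=` \bigcup_k B k].

Lemma tildeA_ideal_sub v S S' : S `<=` S' -> tildeA_ideal v S' ->
  tildeA_ideal v S.
Proof. by move=> SS' [B [hB SB]]; exists B; split=> // x /SS' /SB. Qed.

Lemma tildeA_ideal_bigcup v (S : nat -> set X) :
  (forall k, tildeA_ideal v (S k)) -> tildeA_ideal v (\bigcup_k S k).
Proof.
move=> /choice[B hB].
pose p k : nat * nat := odflt (0, 0)%N (unpickle k).
exists (fun k => B (p k).1 (p k).2); split.
  by move=> k; have [+ _] := hB (p k).1; apply.
move=> x [k _ /(hB k).2[l _ Bx]]; exists (pickle (k, l)) => //.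
by rewrite /p pickleK.
Qed.

Lemma tildeA_idealU v S S' : tildeA_ideal v S -> tildeA_ideal v S' ->
  tildeA_ideal v (S `|` S').
Proof.
move=> hS hS'; rewrite -(bigcup2E S S').
apply: tildeA_ideal_bigcup => -[|[|k]] //=.
by apply: tildeA_ideal_sub hS => x [].
Qed.

Lemma tildeA_ideal_veps v n e S : 0 < e -> tildeA_veps (v n) e S ->
  tildeA_ideal v S.
Proof.
move=> e0 hS; exists (fun=> S); split; last by move=> x Sx; exists 0%N.
by move=> _; exists n, e.
Qed.

End ideal.

(** * Density points on the real line *)

Section density_points.
Context (R : realType).
Local Notation mu := (@lebesgue_measure R).
Implicit Types A : set R.

Definition density_point A t := forall rho : R, 0 < rho ->
  exists2 d, 0 < d & forall s, 0 < s < d ->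
    (mu (ball t s `\` A) <= (rho * s)%:E)%E.

Lemma negligible_nondensity A : measurable A ->
  mu.-negligible [set t | A t /\ ~ density_point A t].
Proof.
move=> mA; have := lebesgue_density mA; apply: negligibleS => t [At nt] /= h.
apply: nt => rho rho0; move: h; rewrite indicE mem_set// => /(_
  [set y | ((1 - rho / 2)%:E < y)%E]) h.
have : \forall r \near 0^'+, ((1 - rho / 2)%:E <
    mu (A `&` ball t r) * (mu (ball t r))^-1)%E.
  apply: h; apply: open_nbhs_nbhs; split; first exact: open_ereal_gt_ereal.
  by rewrite /= lte_fin; lra.
move=> [d /= d0 hd]; exists d => // s /andP[s0 sd].
have {hd} := hd s; rewrite /= sub0r normrN gtr0_norm// => /(_ sd s0).
have mB : measurable (ball t s) by exact: measurable_ball.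
have muB : mu (ball t s) = (s *+ 2)%:E by rewrite lebesgue_measure_ball// ltW.
have mAB : measurable (A `&` ball t s) by exact: measurableI.
have fAB : mu (A `&` ball t s) \is a fin_num.
  rewrite ge0_fin_numE// (@le_lt_trans _ _ (mu (ball t s)))//.
    by rewrite le_measure ?inE.
  by rewrite muB ltry.
have s2 : s *+ 2 != 0 by rewrite mulrn_eq0/= gt_eqF.
rewrite muB inver (negbTE s2) -(fineK fAB) -EFinM lte_fin ltr_pdivlMr; last first.
  by rewrite mulrn_wgt0.
move=> h1.
have -> : mu (ball t s `\` A) = (mu (ball t s) - mu (A `&` ball t s))%E.
  by rewrite setIC; apply: measureD => //; rewrite [X in (X < _)%E]muB ltry.
rewrite muB -(fineK fAB) -EFinB lee_fin.
move: h1; rewrite -mulr_natr; have : (1 - rho / 2) * (s * 2) = s * 2 - rho * s by field.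
lra.
Qed.

(** A gap of size [kappa * `|s|] around [t + s] would occupy a fixed proportion
of the ball of radius [2 * `|s|] around [t]. *)
Lemma density_point_near A t kappa : measurable A -> density_point A t -> 0 < kappa <= 1 ->
  exists2 d, 0 < d & forall s, 0 < `|s| < d ->
    exists2 s', `|s' - s| <= kappa * `|s| & A (t + s').
Proof.
move=> mA At /andP[k0 k1]; have [d d0 hd] := At (kappa / 2) ltac:(lra).
exists (d / 2); first by lra.
move=> s /andP[s0 sd]; apply: contrapT => h.
have {hd} := hd (2 * `|s|); rewrite mulr_gt0//= => /(_ ltac:(lra)).
apply/negP; rewrite -ltNge.
have r0 : 0 < kappa * `|s| by rewrite mulr_gt0.
have mB : measurable (ball (t + s) (kappa * `|s|)) by exact: measurable_ball.
apply: (@lt_le_trans _ _ (mu (ball (t + s) (kappa * `|s|)))).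
  rewrite lebesgue_measure_ball ?ltW// lte_fin [ltRHS]mulr2n.
  by lra.
rewrite le_measure ?inE//.
  by apply: measurableD => //; exact: measurable_ball.
move=> y; rewrite -!ball_normE /= => hy; split.
  have -> : t - y = t + s - y - s by lra.
  apply: le_lt_trans (ler_normB _ _) _.
  have : kappa * `|s| <= `|s| by rewrite ler_piMl.
  by lra.
move=> Ay; apply: h; exists (y - t); last by rewrite addrC subrK.
have -> : y - t - s = - (t + s - y) by lra.
by rewrite normrN ltW.
Qed.

End density_points.

(** * Vector measures dominated by a finite measure *)

Section sequences.
Context (R : realType) (Y : normedModType R).

Lemma cvgn_distP (u : nat -> Y) (l : Y) : u n @[n --> \oo] --> l <->
  forall e : R, 0 < e -> exists N, forall n, (N <= n)%N -> `|u n - l| <= e.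
Proof.
split=> [/cvgrPdist_le h e e0|h].
  by have [N _ hN] := h _ e0; exists N => n Nn; rewrite distrC; exact: hN.
apply/cvgrPdist_le => e e0; have [N hN] := h _ e0.
by exists N => // n /= Nn; rewrite distrC; exact: hN.
Qed.

Lemma cvgn_norm_le (u : nat -> Y) (l : Y) (c : R) : u n @[n --> \oo] --> l ->
  (forall e : R, 0 < e -> exists N, forall n, (N <= n)%N -> `|u n| <= c + e) ->
  `|l| <= c.
Proof.
move=> /cvgn_distP ul uc; apply/ler_addgt0Pr => e e0.
have e2 : 0 < e / 2 by rewrite divr_gt0.
have [N hN] := ul _ e2; have [K hK] := uc _ e2.
have := hN _ (leq_maxl N K); have := hK _ (leq_maxr N K).
set n := maxn N K; have := ler_normB (u n) (u n - l).
by rewrite subKr; lra.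
Qed.

End sequences.

Lemma cvgn_cauchy (R : realType) (Y : completeNormedModType R) (u : nat -> Y) :
  (forall e : R, 0 < e -> exists N, forall n, (N <= n)%N -> `|u n - u N| <= e) ->
  exists l : Y, u n @[n --> \oo] --> l.
Proof.
move=> h; suff /cvg_ex : cvg (u n @[n --> \oo]) by [].
apply/cauchy_cvgP/cauchy_exP => e e0.
have [|N hN] := h (e / 2); first by rewrite divr_gt0.
exists (u N); exists N => // n /= Nn; rewrite -ball_normE /= distrC.
by rewrite (le_lt_trans (hN _ Nn))// ltr_pdivrMr// ltr_pMr// ltr1n.
Qed.

Section dominated.
Context d (T : measurableType d) (R : realType) (Y : completeNormedModType R)
  (mu : {finite_measure set T -> \bar R}).
Implicit Types (A B : set T) (m : set T -> Y) (F : nat -> set T).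

Definition mass A : R := fine (mu A).

Lemma mass_ge0 A : 0 <= mass A. Proof. exact: fine_ge0. Qed.

Lemma mass0 : mass set0 = 0. Proof. by rewrite /mass measure0. Qed.

Lemma massE A : measurable A -> mu A = (mass A)%:E.
Proof. by move=> mA; rewrite fineK// fin_num_measure. Qed.

Lemma massU A B : measurable A -> measurable B -> A `&` B = set0 ->
  mass (A `|` B) = mass A + mass B.
Proof.
by move=> mA mB AB; rewrite /mass measureU// fineD// fin_num_measure.
Qed.

Lemma mass_le A B : measurable A -> measurable B -> A `<=` B -> mass A <= mass B.
Proof.
by move=> mA mB AB; rewrite -lee_fin -!massE//; apply: le_measure => //; rewrite inE.
Qed.

Lemma mass_bigsetU F N : (forall k, measurable (F k)) -> trivIset setT F ->
  mass (\big[setU/set0]_(i < N) F i) = \sum_(i < N) mass (F i).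
Proof.
move=> mF tF; elim: N => [|N IH]; first by rewrite !big_ord0 mass0.
rewrite !big_ord_recr/= massU ?IH//; first exact: bigsetU_measurable.
by apply: (@trivIset_bigsetUI _ xpredT) => // i j _ _; exact: tF.
Qed.

Lemma mass_sigma_additive F : (forall k, measurable (F k)) -> trivIset setT F ->
  forall e : R, 0 < e -> exists N, forall n, (N <= n)%N ->
    mass (\bigcup_k F k) - \sum_(i < n) mass (F i) <= e.
Proof.
move=> mF tF e e0.
have mU : measurable (\bigcup_k F k) by exact: bigcupT_measurable.
have : (\sum_(0 <= i < n) mu (F i))%E @[n --> \oo] --> mu (\bigcup_k F k).
  exact: measure_semi_sigma_additive.
rewrite (_ : (fun n => _) = fun n => (\sum_(i < n) mass (F i))%:E); last first.
  apply/funext => n; rewrite big_mkord -sumEFin; apply: eq_bigr => i _.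
  exact: massE.
rewrite massE// => /fine_cvg /= /cvgrPdist_le/(_ _ e0)[N _ hN].
exists N => n Nn; have := hN n Nn; apply: le_trans; exact: ler_norm.
Qed.

(** Finite additivity together with the domination implies countable additivity,
bounded variation and absolute continuity, and passes to pointwise limits. *)
Definition dominated_additive (M : R) m :=
  (forall A B, measurable A -> measurable B -> A `&` B = set0 ->
    m (A `|` B) = m A + m B) /\
  forall A, measurable A -> `|m A| <= M * mass A.

Section one_dominated.
Variables (M : R) (m : set T -> Y) (hm : dominated_additive M m).

Lemma dominated0 : m set0 = 0.
Proof.
by have := hm.2 _ measurable0; rewrite mass0 mulr0 normr_le0 => /eqP.
Qed.

Lemma dominated_bigsetU F N : (forall k, measurable (F k)) -> trivIset setT F ->
  m (\big[setU/set0]_(i < N) F i) = \sum_(i < N) m (F i).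
Proof.
move=> mF tF; elim: N => [|N IH]; first by rewrite !big_ord0 dominated0.
rewrite !big_ord_recr/= hm.1 ?IH//; first exact: bigsetU_measurable.
by apply: (@trivIset_bigsetUI _ xpredT) => // i j _ _; exact: tF.
Qed.

Lemma dominatedD A B : measurable A -> measurable B -> B `<=` A ->
  m A = m (A `\` B) + m B.
Proof.
move=> mA mB BA; rewrite -hm.1//; first by rewrite setUC setDUK.
  exact: measurableD.
by rewrite setDKI.
Qed.

Lemma dominated_tail F N : (forall k, measurable (F k)) -> trivIset setT F ->
  `|m (\bigcup_k F k) - \sum_(i < N) m (F i)| <=
    M * (mass (\bigcup_k F k) - \sum_(i < N) mass (F i)).
Proof.
move=> mF tF; rewrite -dominated_bigsetU// -mass_bigsetU//.
set U := \bigcup_k F k; set V := \big[_/_]_(_ < _) _.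
have mU : measurable U by exact: bigcupT_measurable.
have mV : measurable V by exact: bigsetU_measurable.
have VU : V `<=` U by rewrite /V -bigcup_mkord; exact: bigcup_subset.
have mD : measurable (U `\` V) by exact: measurableD.
rewrite (dominatedD mU mV VU) addrK.
have -> : mass U = mass (U `\` V) + mass V.
  by rewrite -massU ?setDKI// setUC setDUK.
by rewrite addrK; exact: hm.2.
Qed.

Lemma dominated_vector_measure : vector_measure m.
Proof.
move=> F mF tF; apply/cvgn_distP => e e0.
have M0 : 0 < `|M| + 1 by rewrite ltr_wpDl.
have [|N hN] := mass_sigma_additive mF tF (e := e / (`|M| + 1)).
  by rewrite divr_gt0.
exists N => n Nn; rewrite distrC; apply: le_trans (dominated_tail n mF tF) _.
have := hN n Nn; rewrite ler_pdivlMr// => h; apply: le_trans h.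
rewrite mulrC; apply: ler_wpM2l; last by have := ler_norm M; lra.
rewrite subr_ge0 -mass_bigsetU//; apply: mass_le.
- exact: bigsetU_measurable.
- exact: bigcupT_measurable.
- by rewrite -bigcup_mkord; exact: bigcup_subset.
Qed.

Lemma dominated_bounded_variation : bounded_variation_measure m.
Proof.
exists (`|M| * mass setT) => n F mF tF.
apply: (@le_trans _ _ (`|M| * \sum_(i < n) mass (F i))).
  rewrite mulr_sumr; apply: ler_sum => i _; apply: le_trans (hm.2 _ (mF i)) _.
  by rewrite ler_wpM2r ?mass_ge0// ler_norm.
apply: ler_wpM2l => //; rewrite -mass_bigsetU//; apply: mass_le => //.
exact: bigsetU_measurable.
Qed.

Lemma dominated_absolutely_continuous : absolutely_continuous m mu.
Proof.
move=> e e0; have M0 : 0 < `|M| + 1 by rewrite ltr_wpDl.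
exists (e / (`|M| + 1)); first by rewrite divr_gt0.
move=> E mE; rewrite massE// lte_fin ltr_pdivlMr// => h.
apply: le_lt_trans (hm.2 _ mE) _; apply: le_lt_trans h.
rewrite mulrC; apply: ler_wpM2l; first exact: mass_ge0.
by have := ler_norm M; lra.
Qed.

End one_dominated.

(** By the uniform domination the sets on which the measures converge form a
Dynkin system. *)
Lemma dominated_cvg (M : R) (m_ : nat -> set T -> Y) (G : set (set T)) :
  0 <= M -> (forall n, dominated_additive M (m_ n)) ->
  @measurable _ T = <<s G >> -> setI_closed G ->
  (exists l : Y, m_ n setT @[n --> \oo] --> l) ->
  (forall A, G A -> exists l : Y, m_ n A @[n --> \oo] --> l) ->
  exists2 m, dominated_additive M m &
    forall A, measurable A -> m_ n A @[n --> \oo] --> m A.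
Proof.
move=> M0 hm GE GI [lT hlT] Gcvg.
have cvgm A : measurable A -> exists l : Y, m_ n A @[n --> \oo] --> l.
  rewrite GE; move: A; apply: (dynkin_induction GE GI) => //.
  - by exists lT.
  - move=> S mS [l hl]; exists (lT - l); have -> : (fun n => m_ n (~` S)) =
        (fun n => m_ n setT - m_ n S).
      apply/funext => n.
      by rewrite (dominatedD (hm n) measurableT mS)// setTD addrK.
    exact: cvgB.
  - move=> F mF tF /choice[l hl]; apply: cvgn_cauchy => e e0.
    have M1 : 0 < 4 * (M + 1) by lra.
    have [|N hN] := mass_sigma_additive mF tF (e := e / (4 * (M + 1))).
      by rewrite divr_gt0.
    have hsum : \sum_(i < N) m_ n (F i) @[n --> \oo] --> \sum_(i < N) l i.
      by apply: cvg_big => [|i _]; [exact: add_continuous|exact: hl].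
    have e4 : 0 < e / 4 by lra.
    have /cvgn_distP/(_ _ e4)[K hK] := hsum.
    have tail n : `|m_ n (\bigcup_k F k) - \sum_(i < N) m_ n (F i)| <= e / 4.
      apply: le_trans (dominated_tail (hm n) N mF tF) _.
      apply: le_trans (ler_wpM2l M0 (hN N (leqnn N))) _.
      have -> : e / 4 = (M + 1) * (e / (4 * (M + 1))) by field; lra.
      by apply: ler_wpM2r; [rewrite ltW// divr_gt0|lra].
    exists K => n Kn; have tn := tail n; have tK := tail K.
    have hn := hK n Kn; have hKK := hK K (leqnn K).
    have h1 := ler_distD (\sum_(i < N) m_ n (F i)) (m_ n (\bigcup_k F k))
      (m_ K (\bigcup_k F k)).
    have h2 := ler_distD (\sum_(i < N) l i) (\sum_(i < N) m_ n (F i))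
      (m_ K (\bigcup_k F k)).
    have h3 := ler_distD (\sum_(i < N) m_ K (F i)) (\sum_(i < N) l i)
      (m_ K (\bigcup_k F k)).
    rewrite (distrC (\sum_(i < N) m_ K (F i)) (m_ K (\bigcup_k F k))) in h3.
    rewrite (distrC (\sum_(i < N) l i) (\sum_(i < N) m_ K (F i))) in h3.
    by lra.
have /choice[m mE] : forall A, exists l : Y, measurable A ->
    m_ n A @[n --> \oo] --> l.
  move=> A; have [/cvgm[l hl]|nA] := pselect (measurable A); first by exists l.
  by exists 0.
exists m => //; split=> [A B mA mB AB|A mA].
- have : m_ n (A `|` B) @[n --> \oo] --> m A + m B.
    have -> : (fun n => m_ n (A `|` B)) = (fun n => m_ n A + m_ n B).
      by apply/funext => n; rewrite (hm n).1.
    by apply: cvgD; exact: mE.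
  move=> h; exact: (cvg_unique _ (mE _ (measurableU _ _ mA mB)) h).
- by apply: cvgn_norm_le (mE _ mA) _ => e e0; exists 0%N => n _;
    apply: le_trans ((hm n).2 _ mA) _; rewrite lerDl ltW.
Qed.

End dominated.

(** * The Radon-Nikodym property in terms of pieces *)

Section strong_measurability.
Context d (T : measurableType d) (R : realType) (Y : completeNormedModType R).

Lemma measurable_simple_comp (s : T -> Y) (k : Y -> T -> R) :
  simple_function s -> (forall y, measurable_fun setT (k y)) ->
  measurable_fun setT (fun x => k (s x) x).
Proof.
move=> [fs ms] mk _ B mB; rewrite setTI.
rewrite (_ : _ @^-1` B =
    \bigcup_(y in range s) (s @^-1` [set y] `&` k y @^-1` B)); last first.
  apply/seteqP; split=> [x Bx|x [y _ [/= -> //]]].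
  by exists (s x) => //; exists x.
apply: fin_bigcup_measurable => // y _; apply: measurableI => //.
by rewrite -[X in measurable X]setTI; exact: mk.
Qed.

Lemma measurable_norm_sub_cst (g : T -> Y) (y : Y) : strongly_measurable g ->
  measurable_fun setT (fun x => `|g x - y|).
Proof.
move=> [s hs sg]; apply: (measurable_fun_cvg (h := fun n x => `|s n x - y|)).
  move=> n; apply: (measurable_simple_comp (hs n) (k := fun z _ => `|z - y|)) => z.
  exact: measurable_cst.
by move=> x _; apply: cvg_norm; apply: cvgB; [exact: sg|exact: cvg_cst].
Qed.

Lemma measurable_norm_simple_sub (s g : T -> Y) : simple_function s ->
  strongly_measurable g -> measurable_fun setT (fun x => `|s x - g x|).
Proof.
move=> ss hg; apply: (measurable_simple_comp (k := fun z x => `|z - g x|)) => // z.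
under eq_fun do rewrite distrC; exact: measurable_norm_sub_cst.
Qed.

Variable mu : {finite_measure set T -> \bar R}.

(** On the level set of [s] at [z] the constant [Num.max 0 (`|z - y| - eta)] is
at most [N], and the level sets partition [E]. *)
Lemma simple_integral_dist (E : set T) (s : T -> Y) (N : T -> R) y (eta e : R) :
  measurable E -> simple_function s -> measurable_fun setT N ->
  (forall x, 0 <= N x) -> 0 <= eta ->
  (forall x, E x -> `|s x - y| <= N x + eta) ->
  (\int[mu]_x (N x)%:E <= e%:E)%E ->
  `|simple_integral mu E s - mass mu E *: y| <= eta * mass mu E + e.
Proof.
move=> mE [fs ms] mN N0 eta0 sN Ne.
pose F z := E `&` s @^-1` [set z].
have mF z : measurable (F z) by exact: measurableI.
have tF (D : set Y) : trivIset D F.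
  by move=> z w _ _ [x [[_ /= <-] [_ /= <-]]].
have EF : E = \bigcup_(z in range s) F z.
  apply/seteqP; split=> [x Ex|x [z _ []//]]; exists (s x) => //; exists x => //.
pose S : seq Y := finmap.enum_fset (fset_set (range s)).
have uS : uniq S by exact: finmap.fset_uniq.
have EFS : E = \big[setU/set0]_(z <- S) F z by rewrite /S bigsetU_fset_set.
have massF : mass mu E = \sum_(z <- S) mass mu (F z).
  apply: EFin_inj; rewrite -massE// -sumEFin {1}EF measure_fin_bigcup//.
  by rewrite fsbig_finite//=; apply: eq_bigr => z _; exact: massE.
have -> : simple_integral mu E s = \sum_(z <- S) mass mu (F z) *: z.
  by rewrite /simple_integral fsbig_finite.
rewrite massF scaler_suml -sumrB mulr_sumr.
under eq_bigr do rewrite -scalerBr.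
apply: le_trans (ler_norm_sum _ _ _) _.
pose c z := Num.max 0 (`|z - y| - eta).
apply: (@le_trans _ _ (\sum_(z <- S) (eta * mass mu (F z) + c z * mass mu (F z)))).
  apply: ler_sum => z _; rewrite normrZ ger0_norm ?mass_ge0// -mulrDl mulrC.
  rewrite ler_wpM2r ?mass_ge0// -lerBlDl /c le_max lexx orbT//.
rewrite big_split/= lerD2l -lee_fin; apply: le_trans Ne.
rewrite -sumEFin; apply: (@le_trans _ _ (\int[mu]_(x in E) (N x)%:E)%E); last first.
  by apply: ge0_subset_integral => //; [exact/measurable_EFinP|move=> x _; rewrite lee_fin].
rewrite EFS ge0_integral_bigsetU//; last 2 first.
- by apply/measurable_EFinP; exact: measurable_funTS.
- by move=> x _; rewrite lee_fin.
apply: lee_sum => z _; rewrite EFinM -massE// -integral_cst//.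
apply: ge0_le_integral => //.
- by move=> x _; rewrite lee_fin /c le_max lexx.
- by apply/measurable_EFinP; exact: measurable_funTS.
move=> x [Ex /= sx]; rewrite lee_fin /c ge_max N0 lerBlDr -sx /=.
exact: sN.
Qed.

Lemma bochner_integral_dist (E : set T) (g : T -> Y) (I y : Y) (eta : R) :
  measurable E -> is_bochner_integral mu E g I -> 0 <= eta ->
  (forall x, E x -> `|g x - y| <= eta) ->
  `|I - mass mu E *: y| <= eta * mass mu E.
Proof.
move=> mE [[sg _] [s [hs s0] sI]] eta0 gy.
apply: (cvgn_norm_le (u := fun n => simple_integral mu E (s n) - mass mu E *: y)).
  by apply: cvgB => //; exact: cvg_cst.
move=> e e0; have : \forall n \near \oo, (\int[mu]_x (`|s n x - g x|)%:E < e%:E)%E.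
  apply: (s0 [set z | (z < e%:E)%E]); apply: open_nbhs_nbhs.
  by split; [exact: open_ereal_lt_ereal|rewrite /= lte_fin].
move=> [K _ hK]; exists K => n Kn.
apply: (simple_integral_dist (N := fun x => `|s n x - g x|)) => //.
- exact: measurable_norm_simple_sub.
- move=> x Ex; apply: le_trans (ler_distD (g x) _ _) _.
  by rewrite lerD2l; exact: gy.
- exact/ltW/hK.
Qed.

(** The density is a pointwise limit of simple functions. So its values are in
the closure of a countable set [Z], and each of them is within [eta] of a point
of [Z]. *)
Lemma rnp_pieces (M : R) (m : set T -> Y) (eta : R) :
  radon_nikodym_property Y -> dominated_additive mu M m -> 0 < eta ->
  exists (F : nat -> set T) (y : nat -> Y), [/\ forall i, measurable (F i),
    \bigcup_i F i = setT &
    forall i E, measurable E -> E `<=` F i ->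
      `|m E - mass mu E *: y i| <= eta * mass mu E].
Proof.
move=> rnp hm eta0; have [||g hg] := rnp _ T mu m (dominated_vector_measure hm).
- exact: dominated_bounded_variation hm.
- exact: dominated_absolutely_continuous hm.
have [[sg _] _] := hg _ measurableT.
have [s hs sgx] := sg.
pose Z := \bigcup_n range (s n).
have cZ : countable Z.
  by apply: bigcup_countable => // n _; apply: finite_set_countable; have [] := hs n.
have [[t0]|T0] := pselect (exists t : T, True); last first.
  exists (fun=> set0), (fun=> 0); split => //.
    by apply/seteqP; split=> // x _; exfalso; apply: T0; exists x.
  move=> i E _; rewrite subset0 => ->; rewrite (dominated0 hm) mass0 scale0r subrr normr0.
  by rewrite mulr0.
have [|y yZ] := countable_enum cZ; first by exists (s 0%N t0), 0%N.
exists (fun i => [set x | `|g x - y i| < eta]), y; split.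
- move=> i; rewrite -[X in measurable X]setTI.
  have -> : [set x | `|g x - y i| < eta] =
    (fun x => `|g x - y i|) @^-1` `]-oo, eta[%classic.
    by apply/seteqP; split=> x /=; rewrite in_itv.
  by apply: measurable_norm_sub_cst.
- apply/seteqP; split=> // x _.
  have /cvgn_distP/(_ (eta / 2))[|n hn] := sgx x; first by rewrite divr_gt0.
  have : Z (s n x) by exists n.
  rewrite -yZ => -[i _ yi]; exists i => //=; rewrite yi distrC.
  by rewrite (le_lt_trans (hn _ _))// ltr_pdivrMr// ltr_pMr// ltr1n.
- move=> i E mE EF; apply: bochner_integral_dist (hg _ mE) _ _ => //.
    exact: ltW.
  by move=> x /EF /= /ltW.
Qed.

End strong_measurability.

(** * Almost everywhere differentiability of Lipschitz curves *)

Section lipschitz_measure.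
Context (R : realType) (Y : completeNormedModType R) (h : R -> Y) (M : R).
Hypothesis M0 : 0 <= M.
Hypothesis hM : forall s t, `|h s - h t| <= M * `|s - t|.
Variables (a b : R).
Hypothesis ab : a < b.

Let D : set R := `[a, b[%classic.

Let mD : measurable (D : set (measurableTypeR R)). Proof. exact: measurable_itv. Qed.

Let Doo : (@lebesgue_measure R D < +oo)%E.
Proof. by rewrite lebesgue_measure_itv/= lte_fin ab -EFinB ltry. Qed.

Definition restricted_lebesgue :
    {finite_measure set (measurableTypeR R) -> \bar R} :=
  mfrestr mD Doo.
Local Notation mu := restricted_lebesgue.

Lemma mass_restricted (A : set R) : mass mu A = fine (lebesgue_measure (A `&` D)).
Proof. by []. Qed.

Lemma mass_itv s t : a <= s -> s <= t -> t <= b -> mass mu `[s, t[%classic = t - s.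
Proof.
move=> sa st tb; rewrite mass_restricted setIidl; last first.
  move=> x; rewrite /D /= !in_itv/= => /andP[sx xt].
  by rewrite (le_trans sa sx) (lt_le_trans xt tb).
rewrite lebesgue_measure_itv/= lte_fin; move: st; rewrite le_eqVlt => /orP[/eqP->|->].
  by rewrite ltxx subrr.
by rewrite -EFinB.
Qed.

Definition mesh (n : nat) : R := (b - a) / n.+1%:R.
Definition node (n k : nat) : R := a + k%:R * mesh n.
Definition cell (n k : nat) : set R := `[node n k, node n k.+1[%classic.

(** The vector measure with constant density on each cell whose distribution
function is the piecewise affine interpolation of [h] at the nodes. *)
Definition lipschitz_step (n : nat) (E : set R) : Y :=
  \sum_(k < n.+1) (mass mu (E `&` cell n k) / mesh n) *:
    (h (node n k.+1) - h (node n k)).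

Lemma mesh_gt0 n : 0 < mesh n.
Proof. by rewrite divr_gt0 ?subr_gt0 ?ltr0n. Qed.

Lemma nodeS n k : node n k.+1 = node n k + mesh n.
Proof. by rewrite /node -[in LHS]natr1 mulrDl mul1r addrA. Qed.

Lemma node_diff n k : node n k.+1 - node n k = mesh n.
Proof. by rewrite nodeS addrC addKr. Qed.

Lemma node0 n : node n 0 = a.
Proof. by rewrite /node mul0r addr0. Qed.

Lemma node_last n : node n n.+1 = b.
Proof. by rewrite /node /mesh mulrC divfK ?pnatr_eq0// addrC subrK. Qed.

Lemma node_homo n j k : (j <= k)%N -> node n j <= node n k.
Proof.
by move=> jk; rewrite lerD2l ler_wpM2r ?ler_nat// ltW// mesh_gt0.
Qed.

Let measurable_cell n k : measurable (cell n k : set (measurableTypeR R)).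
Proof. exact: measurable_itv. Qed.

Lemma mass_cell n k : (k <= n)%N -> mass mu (cell n k) = mesh n.
Proof.
move=> kn; have ak : a <= node n k by rewrite -{1}(node0 n) node_homo.
have kb : node n k.+1 <= b by rewrite -(node_last n) node_homo.
by rewrite mass_itv ?node_homo// node_diff.
Qed.

Lemma mass_cells (n j : nat) (E : set (measurableTypeR R)) : measurable E ->
  \sum_(k < j) mass mu (E `&` cell n k) = mass mu (E `&` `[a, node n j[%classic).
Proof.
move=> mE; elim: j => [|j IH].
  by rewrite big_ord0 node0 set_itvco0 setI0 mass0.
have -> : `[a, node n j.+1[%classic = `[a, node n j[%classic `|` cell n j.
  rewrite /cell -itv_bndbnd_setU//= bnd_simp; last exact: node_homo.
  by rewrite -{1}(node0 n) node_homo.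
rewrite big_ord_recr/= IH setIUr massU//.
- by apply: measurableI => //; exact: measurable_itv.
- by apply: measurableI => //; exact: measurable_itv.
- apply/seteqP; split=> // x [[_ +] [_ +]] /=; rewrite /cell /= !in_itv/=.
  by move=> /andP[_ xj] /andP[jx _]; have := lt_le_trans xj jx; rewrite ltxx.
Qed.

Lemma lipschitz_step_dominated n : dominated_additive mu M (lipschitz_step n).
Proof.
have w0 := mesh_gt0 n; split=> [A B mA mB AB|A mA].
  rewrite -big_split/=; apply: eq_bigr => k _; rewrite -scalerDl -mulrDl.
  rewrite setIUl massU//; [exact: measurableI|exact: measurableI|].
  by rewrite setIACA AB set0I.
apply: le_trans (ler_norm_sum _ _ _) _.
apply: (@le_trans _ _ (\sum_(k < n.+1) M * mass mu (A `&` cell n k))).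
  apply: ler_sum => k _; rewrite normrZ ger0_norm; last first.
    by rewrite divr_ge0 ?mass_ge0// ltW.
  have := hM (node n k.+1) (node n k); rewrite node_diff (gtr0_norm w0) => h1.
  have := ler_wpM2l (mass_ge0 mu (A `&` cell n k)) h1.
  rewrite -(ler_pM2r (x := (mesh n)^-1)) ?invr_gt0// => h2.
  rewrite mulrAC; apply: le_trans h2 _.
  by rewrite mulrA mulfK ?gt_eqF// mulrC.
rewrite -mulr_sumr mass_cells// node_last; apply: ler_wpM2l => //.
by apply: mass_le => //; apply: measurableI => //; exact: measurable_itv.
Qed.

Lemma lipschitz_step_eq n A B : A `&` D = B `&` D ->
  lipschitz_step n A = lipschitz_step n B.
Proof.
move=> AB; apply: eq_bigr => k _; congr ((_ / _) *: _).
by rewrite !mass_restricted setIAC AB setIAC.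
Qed.

Lemma lipschitz_step_itv n t : a <= t -> t <= b ->
  `|lipschitz_step n `]-oo, t[%classic - (h t - h a)| <= 2 * M * mesh n.
Proof.
move=> at_ tb; have w0 := mesh_gt0 n.
pose c k := mass mu (`]-oo, t[%classic `&` cell n k) / mesh n.
have c1 k : (k <= n)%N -> node n k.+1 <= t -> c k = 1.
  move=> kn kt; rewrite /c setIidr ?mass_cell ?divff ?gt_eqF//.
  by move=> x /=; rewrite !in_itv/= => /andP[_ xk]; exact: lt_le_trans kt.
have c0 k : t <= node n k -> c k = 0.
  move=> tk; rewrite /c (_ : _ `&` _ = set0) ?mass0 ?mul0r//.
  apply/seteqP; split=> // x [/=]; rewrite !in_itv/= => xt /andP[kx _].
  by have := lt_le_trans xt (le_trans tk kx); rewrite ltxx.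
have c01 k : (k <= n)%N -> 0 <= c k <= 1.
  move=> kn; rewrite divr_ge0 ?mass_ge0 ?(ltW w0)//= ler_pdivrMr// mul1r.
  rewrite -(mass_cell kn); apply: mass_le => //.
  by apply: measurableI => //; exact: measurable_itv.
pose S j := \sum_(k < j) c k *: (h (node n k.+1) - h (node n k)).
have hS j : (j <= n.+1)%N -> (node n j <= t -> S j = h (node n j) - h a) /\
    (t < node n j -> `|S j - (h t - h a)| <= 2 * M * mesh n).
  elim: j => [_|j IH jn].
    rewrite node0 /S big_ord0 subrr; split=> // ta.
    by have := lt_le_trans ta at_; rewrite ltxx.
  have [IH1 IH2] := IH (ltnW jn).
  have SS : S j.+1 = S j + c j *: (h (node n j.+1) - h (node n j)).
    by rewrite /S big_ord_recr.
  split=> [jt|tj].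
    rewrite SS c1// scale1r IH1; first by rewrite addrC subrKA.
    by apply: le_trans jt; exact: node_homo.
  have [jt|tj'] := leP (node n j) t; last first.
    by rewrite SS c0 ?(ltW tj')// scale0r addr0; exact: IH2.
  have hd : `|h (node n j.+1) - h (node n j)| <= M * mesh n.
    by apply: le_trans (hM _ _) _; rewrite node_diff gtr0_norm.
  have ht : `|h (node n j) - h t| <= M * mesh n.
    apply: le_trans (hM _ _) _; apply: ler_wpM2l => //.
    rewrite distrC ger0_norm ?subr_ge0// lerBlDl -nodeS; exact: ltW.
  have /andP[cj0 cj1] := c01 j jn.
  rewrite SS IH1//.
  have -> : h (node n j) - h a + c j *: (h (node n j.+1) - h (node n j)) -
      (h t - h a) = (h (node n j) - h t) +
        c j *: (h (node n j.+1) - h (node n j)).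
    by rewrite addrAC opprB subrKA.
  apply: le_trans (ler_normD _ _) _; rewrite normrZ ger0_norm//.
  have : c j * `|h (node n j.+1) - h (node n j)| <= M * mesh n.
    by apply: le_trans hd; rewrite ler_piMl.
  by lra.
have [h1 h2] := hS n.+1 (leqnn _); have [tb'|tb'] := ltP t b.
  by apply: h2; rewrite node_last.
have tbE : t = b by apply/eqP; rewrite eq_le tb.
have -> : lipschitz_step n `]-oo, t[%classic = S n.+1 by [].
rewrite h1; last by rewrite node_last.
by rewrite node_last tbE subrr normr0 mulr_ge0 ?(ltW w0)// mulr_ge0.
Qed.

Lemma lipschitz_step_cvg t : a <= t -> t <= b ->
  lipschitz_step n `]-oo, t[%classic @[n --> \oo] --> h t - h a.
Proof.
move=> at_ tb; apply/cvgn_distP => e e0.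
pose K := 2 * M * (b - a) + 1.
have K0 : 0 < K by rewrite ltr_wpDl// !mulr_ge0// subr_ge0 ltW.
have [N hN] := inv_small (divr_gt0 e0 K0).
exists N => n Nn; apply: le_trans (lipschitz_step_itv _ at_ tb) _.
have : n.+1%:R^-1 <= e / K.
  apply: le_trans (ltW hN); rewrite lef_pV2 ?posrE ?ltr0n// ler_nat ltnS//.
rewrite ler_pdivlMr// mulrC => h1; apply: le_trans h1.
rewrite /mesh mulrA; apply: ler_wpM2r; first by rewrite invr_ge0.
by rewrite /K lerDl.
Qed.

(** The Stieltjes measure of the curve [h], as the limit of those of its
piecewise affine interpolations. *)
Lemma lipschitz_measure : exists2 m : set R -> Y, dominated_additive mu M m &
  forall s t, a <= s -> s <= t -> t <= b -> m `[s, t[%classic = h t - h s.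
Proof.
have stepT : (fun n => lipschitz_step n setT) =
    (fun n => lipschitz_step n `]-oo, b[%classic).
  apply/funext => n; apply: lipschitz_step_eq; rewrite setTI setIidr//.
  by move=> x; rewrite /D /= !in_itv/= => /andP[].
have [||||m hm mE] := @dominated_cvg _ _ R Y mu M lipschitz_step
    (@RGenInftyO.G R) M0 lipschitz_step_dominated.
- exact: RGenInftyO.measurableE.
- move=> _ _ [x ->] [y ->]; exists (Num.min x y).
  by apply/seteqP; split=> z /=; rewrite !in_itv/= lt_min => /andP.
- by exists (h b - h a); rewrite stepT; apply: lipschitz_step_cvg => //; exact: ltW.
- move=> _ [x ->]; have [xa|ax] := ltP x a.
    exists 0; rewrite (_ : (fun n => _) = fun=> 0); first exact: cvg_cst.
    apply/funext => n; rewrite (@lipschitz_step_eq n _ set0).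
      exact: (dominated0 (lipschitz_step_dominated n)).
    apply/seteqP; split=> [z [/=]|z []//]; rewrite /D /= !in_itv/= => zx /andP[az _].
    by have := lt_trans (le_lt_trans az zx) xa; rewrite ltxx.
  have [xb|bx] := leP x b; first by exists (h x - h a); exact: lipschitz_step_cvg.
  exists (h b - h a); rewrite (_ : (fun n => _) = (fun n => lipschitz_step n setT)).
    by rewrite stepT; apply: lipschitz_step_cvg => //; exact: ltW.
  apply/funext => n; apply: lipschitz_step_eq; rewrite setTI setIidr//.
  by move=> z; rewrite /D /= !in_itv/= => /andP[_ zb]; exact: lt_trans zb bx.
exists m => // s t sa st tb.
have mI x : a <= x -> x <= b -> m `]-oo, x[%classic = h x - h a.
  move=> ax xb; have mx : measurable (`]-oo, x[%classic : set (measurableTypeR R)).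
    exact: measurable_itv.
  exact: (cvg_unique _ (mE _ mx) (lipschitz_step_cvg ax xb)).
have := dominatedD hm (A := `]-oo, t[%classic) (B := `]-oo, s[%classic).
rewrite !mI ?(le_trans sa)// ?(le_trans st)// => h1.
have -> : `[s, t[%classic = `]-oo, t[%classic `\` `]-oo, s[%classic.
  apply/seteqP; split=> x /=; rewrite !in_itv/=.
    by move=> /andP[sx xt]; split=> //; apply/negP; rewrite -leNgt.
  by move=> [xt /negP]; rewrite -leNgt xt andbT.
apply: (addIr (h s - h a)); rewrite -h1 ?subrKA//; try exact: measurable_itv.
by move=> x /=; rewrite !in_itv/= => xs; exact: lt_le_trans st.
Qed.

End lipschitz_measure.

Section rademacher.
Context (R : realType) (Y : completeNormedModType R).
Implicit Types (h : R -> Y) (K : set R).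
Local Notation leb := (@lebesgue_measure R).

Definition almost_diff_within h K (eta : R) (t : R) := exists (y : Y) (d : R),
  0 < d /\ forall s, `|s| < d -> K (t + s) ->
    `|h (t + s) - h t - s *: y| <= eta * `|s|.

(** Let [t] be a density point of a piece [F i]. Most of the interval between
[t] and [t + s] lies in [F i], where the increments of [h] are close to [y i]
times the length; the rest contributes at most [M + `|y i|] times its length,
which is a small multiple of [s]. *)
Lemma rademacher_itv h (M a b eta : R) : radon_nikodym_property Y -> 0 <= M ->
  (forall s t, `|h s - h t| <= M * `|s - t|) -> a < b -> 0 < eta ->
  leb.-negligible [set t | a < t < b /\ ~ almost_diff_within h setT eta t].
Proof.
move=> rnp M0 hM ab eta0.
have [m hm mE] := lipschitz_measure M0 hM ab.
have eta2 : 0 < eta / 2 by rewrite divr_gt0.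
have [F [y [mF FT Fy]]] := rnp_pieces rnp hm eta2.
have : leb.-negligible (\bigcup_i [set t | F i t /\ ~ density_point (F i) t]).
  by apply: negligible_bigcup => i; exact: negligible_nondensity (mF i).
apply: negligibleS => t [/andP[at_ tb] nt].
have [i _ Fit] : (\bigcup_i F i) t by rewrite FT.
exists i => //; split=> // dt; apply: nt.
pose C := M + `|y i| + 1; have C0 : 0 < C by rewrite ltr_wpDl// addr_ge0.
pose rho := eta / (4 * C).
have rho0 : 0 < rho by rewrite divr_gt0// mulr_gt0.
have [d d0 hd] := dt _ rho0.
exists (y i), (Num.min (d / 2) (Num.min (t - a) (b - t))); split.
  by rewrite !lt_min !subr_gt0 at_ tb divr_gt0.
have itv s1 s2 s : a <= s1 -> s1 <= s2 -> s2 <= b -> 0 < s < d / 2 ->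
    s2 - s1 = s -> t - s <= s1 -> s2 <= t + s ->
    `|h s2 - h s1 - s *: y i| <= eta * s.
  move=> as1 s12 s2b /andP[s0 sd] ss ts1 ts2.
  pose I : set (measurableTypeR R) := `[s1, s2[%classic.
  have mI : measurable I by exact: measurable_itv.
  rewrite -mE//.
  have mA : measurable (I `&` F i) by exact: measurableI.
  have mB : measurable (I `\` F i) by exact: measurableD.
  have AB : (I `&` F i) `&` (I `\` F i) = set0.
    by apply/seteqP; split=> // x [[_ ?] []].
  have hI : m I = m (I `&` F i) + m (I `\` F i) by rewrite -hm.1// setUIDK.
  have massI : mass (restricted_lebesgue ab) (I `&` F i) +
      mass (restricted_lebesgue ab) (I `\` F i) = s.
    by rewrite -massU// setUIDK mass_itv.
  have massB : mass (restricted_lebesgue ab) (I `\` F i) <= rho * (2 * s).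
    rewrite -lee_fin -massE//; apply: le_trans (hd (2 * s) _); last first.
      by apply/andP; split; [rewrite mulr_gt0|lra].
    rewrite /restricted_lebesgue /= /mfrestr /mrestr.
    apply: le_measure; rewrite ?inE.
    - by apply: measurableI => //; exact: measurable_itv.
    - by apply: measurableD => //; exact: measurable_ball.
    - move=> x [[Ix nF] _]; split=> //; rewrite -ball_normE /=.
      move: Ix; rewrite /I /= in_itv/= => /andP[s1x xs2].
      by rewrite ltr_norml; apply/andP; split; lra.
  have hA := Fy i _ mA (@subIsetr _ _ _).
  have hB := hm.2 _ mB.
  rewrite hI -massI.
  set mu := mass (restricted_lebesgue ab) in massI massB hA hB *.
  have -> : m (I `&` F i) + m (I `\` F i) -
      (mu (I `&` F i) + mu (I `\` F i)) *: y i =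
    (m (I `&` F i) - mu (I `&` F i) *: y i) + m (I `\` F i) -
      mu (I `\` F i) *: y i.
    by rewrite scalerDl opprD addrA; congr (_ - _); rewrite addrAC.
  have h1 := ler_normB (m (I `&` F i) - mu (I `&` F i) *: y i + m (I `\` F i))
    (mu (I `\` F i) *: y i).
  have h2 := ler_normD (m (I `&` F i) - mu (I `&` F i) *: y i) (m (I `\` F i)).
  have muB0 : 0 <= mu (I `\` F i) by exact: mass_ge0.
  have muA0 : 0 <= mu (I `&` F i) by exact: mass_ge0.
  have h3 : `|mu (I `\` F i) *: y i| = `|y i| * mu (I `\` F i).
    by rewrite normrZ ger0_norm// mulrC.
  have h4 : (M + `|y i|) * mu (I `\` F i) <= eta / 2 * s.
    apply: (@le_trans _ _ (C * (rho * (2 * s)))).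
      apply: ler_pM => //; first by rewrite addr_ge0.
      by rewrite /C lerDl.
    rewrite /rho le_eqVlt; apply/orP; left; apply/eqP; field.
    by rewrite gt_eqF.
  have h5 : eta / 2 * mu (I `&` F i) <= eta / 2 * s.
    by rewrite ler_wpM2l ?(ltW eta2)// -massI lerDl.
  have : (M + `|y i|) * mu (I `\` F i) = M * mu (I `\` F i) + `|y i| * mu (I `\` F i) by ring.
  rewrite massI; have -> : eta * s = eta / 2 * s + eta / 2 * s by field.
  by lra.
move=> s; rewrite !lt_min => /and3P[sd sa sb] _.
have [s0|s0|->] := ltgtP s 0.
- have -> : h (t + s) - h t - s *: y i = - (h t - h (t + s) - (- s) *: y i).
    by rewrite scaleNr opprK opprD opprB.
  have sN := ltr0_norm s0; rewrite normrN sN; rewrite sN in sd sa sb.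
  by apply: itv; lra.
- have sP := gtr0_norm s0; rewrite sP; rewrite sP in sd sa sb.
  by apply: itv; lra.
- by rewrite addr0 subrr sub0r scale0r oppr0 !normr0 mulr0.
Qed.

Lemma rademacher h (M eta : R) : radon_nikodym_property Y -> 0 <= M ->
  (forall s t, `|h s - h t| <= M * `|s - t|) -> 0 < eta ->
  leb.-negligible [set t | ~ almost_diff_within h setT eta t].
Proof.
move=> rnp M0 hM eta0.
have : leb.-negligible (\bigcup_n [set t |
    - n.+1%:R < t < n.+1%:R /\ ~ almost_diff_within h setT eta t]).
  apply: negligible_bigcup => n; apply: rademacher_itv rnp M0 hM _ eta0.
  by rewrite (@lt_trans _ _ 0)// ?oppr_lt0 ltr0n.
apply: negligibleS => t nt.
exists (Num.truncn `|t|) => //; split=> //.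
by rewrite -ltr_norml truncnS_gt.
Qed.

End rademacher.

(** * Lipschitz extension from closed subsets of the line *)

Lemma closure_inf (R : realType) (A : set R) :
  A !=set0 -> has_lbound A -> closure A (inf A).
Proof.
move=> A0 lA B /nbhs_ballP[e /= e0 eB].
have [x Ax xe] := inf_adherent e0 (conj A0 lA).
exists x; split=> //; apply: eB; rewrite -ball_normE /=.
by rewrite ler0_norm ?subr_le0 ?ge_inf// opprB ltrBlDl.
Qed.

Section extension.
Context (R : realType) (Y : normedModType R) (h : R -> Y) (K : set R) (M : R).
Hypothesis M0 : 0 <= M.
Hypothesis hM : forall s t, K s -> K t -> `|h s - h t| <= M * `|s - t|.

(** The ends of the gap of [K] around [t]. When [t] is beyond all of [K], both
are the extreme point of [K]; the interpolation is then constant, the division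
by [p.2 - p.1 = 0] giving [0]. *)
Definition neighbours (t : R) (p : R * R) := [/\ K p.1, K p.2 &
  [\/ p.1 <= t <= p.2 /\ (forall x, K x -> x <= p.1 \/ p.2 <= x),
      p.1 = p.2 /\ t <= p.1 /\ (forall x, K x -> p.1 <= x) |
      p.1 = p.2 /\ p.1 <= t /\ (forall x, K x -> x <= p.1)]].

Lemma neighbours_ex t : closed K -> K !=set0 -> exists p, neighbours t p.
Proof.
move=> cK [k Kk].
pose L := K `&` [set x | x <= t]; pose U := K `&` [set x | t <= x].
have supL : L !=set0 -> [/\ K (sup L), sup L <= t & forall x, K x -> x <= t -> x <= sup L].
  move=> L0; have hL : has_sup L by split=> //; exists t => x [].
  split.
  - by apply: cK; apply: closure_subset (closure_sup L0 hL.2) => x [].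
  - by apply: ge_sup => // x [].
  - by move=> x Kx xt; apply: ub_le_sup; [exact: hL.2|].
have infU : U !=set0 -> [/\ K (inf U), t <= inf U & forall x, K x -> t <= x -> inf U <= x].
  move=> U0; have hU : has_inf U by split=> //; exists t => x [].
  split.
  - by apply: cK; apply: closure_subset (closure_inf U0 hU.2) => x [].
  - by apply: lb_le_inf => // x [].
  - by move=> x Kx xt; apply: ge_inf; [exact: hU.2|].
have [/supL[KL Lt hL]|nL] := pselect (L !=set0); last first.
  have tK x : K x -> t < x.
    by move=> Kx; rewrite ltNge; apply/negP => xt; apply: nL; exists x.
  have [|KU tU hU] := infU; first by exists k; split=> //; exact/ltW/tK.
  exists (inf U, inf U); split=> //; apply: Or32; split=> //; split=> // x Kx.
  by apply: hU => //; exact/ltW/tK.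
have [/infU[KU tU hU]|nU] := pselect (U !=set0); last first.
  have tK x : K x -> x < t.
    by move=> Kx; rewrite ltNge; apply/negP => xt; apply: nU; exists x.
  exists (sup L, sup L); split=> //; apply: Or33; split=> //; split=> // x Kx.
  by apply: hL => //; exact/ltW/tK.
exists (sup L, inf U); split=> //; apply: Or31; split; first by rewrite /= Lt.
by move=> x Kx; have [xt|/ltW tx] := leP x t; [left; exact: hL|right; exact: hU].
Qed.

Definition interpolate (p : R * R) (t : R) : Y :=
  h p.1 + ((t - p.1) / (p.2 - p.1)) *: (h p.2 - h p.1).

Lemma interpolate_lipschitz p s t : K p.1 -> K p.2 ->
  `|interpolate p s - interpolate p t| <= M * `|s - t|.
Proof.
move=> K1 K2; rewrite /interpolate opprD addrACA subrr add0r -scalerBl.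
rewrite -mulrBl opprB addrA subrK normrZ normrM.
have [e|ne] := eqVneq p.1 p.2.
  by rewrite e !subrr normr0 mulr0 mulr_ge0.
have n0 : 0 < `|p.2 - p.1| by rewrite normr_gt0 subr_eq0 eq_sym.
rewrite normfV -mulrA mulrC; apply: ler_wpM2r => //.
by rewrite mulrC ler_pdivrMr//; exact: hM.
Qed.

Lemma interpolate1 p : interpolate p p.1 = h p.1.
Proof. by rewrite /interpolate subrr mul0r scale0r addr0. Qed.

Lemma interpolate2 p : interpolate p p.2 = h p.2.
Proof.
have [e|ne] := eqVneq p.1 p.2; first by rewrite -[in LHS]e interpolate1 e.
by rewrite /interpolate divff ?subr_eq0 1?eq_sym// scale1r addrC subrK.
Qed.

Lemma interpolate_dist p t x : neighbours t p -> K x ->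
  `|interpolate p t - h x| <= M * `|t - x|.
Proof.
move=> [K1 K2 hp] Kx.
have step k : K k -> `|interpolate p t - h k| <= M * `|t - k| ->
    `|t - k| + `|k - x| = `|t - x| -> `|interpolate p t - h x| <= M * `|t - x|.
  move=> Kk hk <-; rewrite mulrDr; apply: le_trans (ler_distD (h k) _ _) _.
  by apply: lerD => //; exact: hM.
have h1 := interpolate_lipschitz t p.1 K1 K2; rewrite interpolate1 in h1.
have h2 := interpolate_lipschitz t p.2 K1 K2; rewrite interpolate2 in h2.
case: hp => [[/andP[pt tp] /(_ _ Kx)[xp|px]]|[e [tp /(_ _ Kx) px]]|[e [pt /(_ _ Kx) xp]]].
- apply: (step p.1) => //.
  by rewrite !ger0_norm ?subr_ge0//; [rewrite addrA subrK|exact: le_trans pt].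
- apply: (step p.2) => //; rewrite !ler0_norm ?subr_le0//; first by lra.
  exact: le_trans px.
- apply: (step p.1) => //; rewrite !ler0_norm ?subr_le0//; first by lra.
  exact: le_trans px.
- apply: (step p.1) => //; rewrite !ger0_norm ?subr_ge0//; first by lra.
  exact: le_trans pt.
Qed.

(** Two points are compared through a point of [K] between them, if there is
one. Otherwise they have the same neighbours, and the same affine formula
applies to both. *)
Lemma lipschitz_extension : closed K -> exists g : R -> Y,
  (forall t, K t -> g t = h t) /\ forall s t, `|g s - g t| <= M * `|s - t|.
Proof.
move=> cK; have [K0|K0] := pselect (K !=set0); last first.
  exists (fun=> 0); split=> [t Kt|s t]; first by case: K0; exists t.
  by rewrite subrr normr0 mulr_ge0.
have /choice[p hp] := fun t => neighbours_ex t cK K0.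
exists (fun t => interpolate (p t) t); split=> [t Kt|].
  have := interpolate_dist (hp t) Kt; rewrite subrr normr0 mulr0 normr_le0.
  by rewrite subr_eq0 => /eqP.
have wlog_le s t : s <= t ->
    `|interpolate (p s) s - interpolate (p t) t| <= M * `|s - t|.
  move=> st; have [[x [Kx sx xt]]|nx] := pselect (exists x, [/\ K x, s <= x & x <= t]).
    have h1 := interpolate_dist (hp s) Kx; have h2 := interpolate_dist (hp t) Kx.
    rewrite distrC in h2.
    apply: le_trans (ler_distD (h x) _ _) _; apply: le_trans (lerD h1 h2) _.
    have -> : `|s - x| = x - s by rewrite ler0_norm ?subr_le0// opprB.
    have -> : `|t - x| = t - x by rewrite ger0_norm ?subr_ge0.
    have -> : `|s - t| = t - s by rewrite ler0_norm ?subr_le0// opprB.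
    by rewrite -mulrDr ler_wpM2l//; lra.
  have out x : K x -> x < s \/ t < x.
    move=> Kx; have [|sx] := ltP x s; first by left.
    by have [xt|] := leP x t; [case: nx; exists x|right].
  have [K1 K2 hs] := hp s; have [K1' K2' ht] := hp t.
  suff e : p s = p t by rewrite -e; apply: interpolate_lipschitz.
  have o1 := out _ K1; have o2 := out _ K2; have o1' := out _ K1'.
  have o2' := out _ K2'.
  suff [e1 e2] : (p s).1 = (p t).1 /\ (p s).2 = (p t).2.
    by rewrite [p s]surjective_pairing [p t]surjective_pairing e1 e2.
  (* in each pair of positions relative to [K], the two gaps cannot be different
     without one of their ends being in [s, t] *)
  move: hs ht; case=> [[/andP[u1 u2] c]|[e [u c]]|[e [u c]]];
    case=> [[/andP[w1 w2] c']|[e' [w c']]|[e' [w c']]];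
    have := c _ K1'; have := c _ K2'; have := c' _ K1; have := c' _ K2; lra.
move=> s t; have [|/ltW] := leP s t; first exact: wlog_le.
by move=> ts; rewrite distrC [`|s - t|]distrC; exact: wlog_le.
Qed.

End extension.

Lemma rademacher_within (R : realType) (Y : completeNormedModType R)
    (h : R -> Y) (K : set R) (M eta : R) :
  radon_nikodym_property Y -> 0 <= M -> closed K ->
  (forall s t, K s -> K t -> `|h s - h t| <= M * `|s - t|) -> 0 < eta ->
  (@lebesgue_measure R).-negligible
    [set t | K t /\ ~ almost_diff_within h K eta t].
Proof.
move=> rnp M0 cK hM eta0; have [g [gh gM]] := lipschitz_extension M0 hM cK.
have := rademacher rnp M0 gM eta0; apply: negligibleS => t [Kt nt] [y [d [d0 hd]]].
apply: nt; exists y, d; split=> // s sd Ks.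
by rewrite -(gh t)// -(gh (t + s))//; exact: hd.
Qed.

(** * Null sets along curves *)

Section borel.
Context (T : ptopologicalType).

Lemma borel_closed (A : set T) : closed A -> <<s @open T >> A.
Proof.
move=> cA; rewrite -[A]setCK.
by apply: (@measurableC _ (g_sigma_algebraType (@open T)));
  apply: sub_sigma_algebra; exact: closed_openC.
Qed.

Lemma borel_setD (A B : set T) : <<s @open T >> A -> <<s @open T >> B ->
  <<s @open T >> (A `\` B).
Proof. exact: (@measurableD _ (g_sigma_algebraType (@open T))). Qed.

Lemma borel_setI (A B : set T) : <<s @open T >> A -> <<s @open T >> B ->
  <<s @open T >> (A `&` B).
Proof. exact: (@measurableI _ (g_sigma_algebraType (@open T))). Qed.

Lemma borel_setU (A B : set T) : <<s @open T >> A -> <<s @open T >> B ->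
  <<s @open T >> (A `|` B).
Proof. exact: (@measurableU _ (g_sigma_algebraType (@open T))). Qed.

Lemma borel_bigcup (A : nat -> set T) : (forall k, <<s @open T >> (A k)) ->
  <<s @open T >> (\bigcup_k A k).
Proof. exact: (@bigcupT_measurable _ (g_sigma_algebraType (@open T))). Qed.

End borel.

Section curves.
Context (R : realType) (X : normedModType R).
Variables (phi : R -> X) (v : X) (eps : R).
Hypothesis hphi : eps.-lipschitz (fun t : R^o => phi t - t *: v).

Lemma curve_dist s t : `|phi s - phi t - (s - t) *: v| <= eps * `|s - t|.
Proof.
have -> : phi s - phi t - (s - t) *: v = phi s - s *: v - (phi t - t *: v).
  by rewrite scalerBl !opprB addrACA [RHS]addrACA; congr (_ + _); exact: addrC.
exact: (hphi (x := (s, t)) (conj I I)).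
Qed.

Lemma curve_step s s' t : `|phi t + s *: v - phi (t + s')| <=
  eps * `|s'| + `|s' - s| * `|v|.
Proof.
have := curve_dist (t + s') t; rewrite [t + s' - t]addrC addKr => h.
have -> : phi t + s *: v - phi (t + s') =
    - (phi (t + s') - phi t - s' *: v) - (s' - s) *: v.
  by rewrite scalerBl !opprB [s' *: v + _]addrC -[RHS]addrA [s' *: v + _]addrC
    subrK addrAC.
apply: le_trans (ler_normB _ _) _; rewrite normrN normrZ.
exact: lerD.
Qed.

Lemma curve_lipschitz s t : `|phi s - phi t| <= (`|v| + eps) * `|s - t|.
Proof.
rewrite -[phi s - phi t](subrK ((s - t) *: v)).
apply: le_trans (ler_normD _ _) _; rewrite normrZ.
by have := curve_dist s t; rewrite mulrDl; lra.
Qed.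

Lemma curve_continuous : continuous phi.
Proof.
move=> t; apply/cvgrPdist_le => e e0.
pose W := `|v| + eps; have W0 : 0 < `|W| + 1 by rewrite ltr_wpDl.
near=> s; apply: le_trans (curve_lipschitz _ _) _.
apply: (@le_trans _ _ ((`|W| + 1) * `|t - s|)).
  by apply: ler_wpM2r => //; rewrite -/W; have := ler_norm W; lra.
rewrite mulrC -ler_pdivlMr//; near: s.
apply/nbhs_ballP; exists (e / (`|W| + 1)) => /=; first by rewrite divr_gt0.
by move=> s; exact: ltW.
Unshelve. all: by end_near. Qed.

Lemma closed_curve_preimage (E : set X) : closed E -> closed (phi @^-1` E).
Proof. by move=> cE; apply: closed_comp => // t _; exact: curve_continuous. Qed.

End curves.

(** Along a curve in a direction close to [v], a hole of [E] seen in the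
direction [v] is a gap of the preimage of [E], of comparable size; so points
of porosity are not density points of that preimage. *)
Lemma porous_tildeA_veps (R : realType) (X : normedModType R) (E : set X) v c :
  closed E -> 0 < c -> tildeA_veps v (c / 2) (porous E v c).
Proof.
move=> cE c0; split.
  apply: borel_setD; first exact: borel_closed.
  by apply: borel_bigcup => j; apply: borel_closed; exact: closed_nonporous.
move=> phi hphi; pose K : set R := phi @^-1` E.
have cK : closed K by exact: closed_curve_preimage hphi _ cE.
have mK := closed_measurable cK.
apply: negligibleS (negligible_nondensity mK) => t /porousP[Et pt].
split=> // dt; pose kappa := c / (2 * (`|v| + c)).
have vc0 : 0 < `|v| + c by rewrite ltr_wpDl.
have kE : kappa * (`|v| + c) = c / 2.
  by rewrite /kappa; field; rewrite gt_eqF.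
have k0 : 0 < kappa by rewrite divr_gt0// mulr_gt0.
have k1 : kappa <= 1.
  by rewrite ler_pdivrMr ?mulr_gt0// mul1r; have := normr_ge0 v; lra.
have [d d0 hd] := density_point_near mK dt (introT andP (conj k0 k1)).
apply: (pt d) => //; split=> // s c' sd cc'.
have [s' ss' Ks'] := hd s sd; exists (phi (t + s')) => //.
apply: le_trans (curve_step hphi _ _ _) _.
apply: (@le_trans _ _ (c * `|s|)); last by rewrite ler_wpM2r// ltW.
have h1 : `|s'| <= (1 + kappa) * `|s|.
  by have := ler_normD (s' - s) s; rewrite subrK; lra.
have h2 : c / 2 * `|s'| <= c / 2 * ((1 + kappa) * `|s|).
  by rewrite ler_wpM2l//; lra.
have h3 : `|s' - s| * `|v| <= kappa * `|s| * `|v| by exact: ler_wpM2r.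
apply: le_trans (lerD h2 h3) _.
have -> : c / 2 * ((1 + kappa) * `|s|) + kappa * `|s| * `|v| =
  (c / 2 + kappa * (c / 2) + kappa * `|v|) * `|s| by ring.
apply: ler_wpM2r => //; move: kE; rewrite mulrDr => kE.
have : 0 <= kappa * c by rewrite mulr_ge0// ltW.
by lra.
Qed.

Section nondifferentiability.
Context (R : realType) (X Y : completeNormedModType R) (f : X -> Y).

Definition almost_diff (u : X) (eta : R) (x : X) := exists (z : Y) (d : R),
  0 < d /\ forall t, `|t| < d -> `|f (x + t *: u) - f x - t *: z| <= eta * `|t|.

(** Almost every [t] in [K i] is both a density point of [K i] and a point of
approximate differentiability of [f \o phi] on [K i]. For such a [t] and small
[s], some [t + s'] in [K i] has [s'] close to [s]; then [phi (t + s')] is a point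
of [E] close to [phi t + s *: v], at which the Lipschitz estimate for [f]
applies. *)
Lemma negligible_not_almost_diff (E : set X) (M r eta : R) (v : X) (phi : R -> X) :
  separable X -> radon_nikodym_property Y -> closed E -> 0 <= M -> 0 < r ->
  (forall x y, E x -> `|y - x| < r -> `|f y - f x| <= M * `|y - x|) ->
  0 < eta ->
  (eta / (8 * (M + 1))).-lipschitz (fun t : R^o => phi t - t *: v) ->
  (@lebesgue_measure R).-negligible
    (phi @^-1` [set x | E x /\ ~ almost_diff v eta x]).
Proof.
move=> /separable_seq[e edense] rnp cE M0 r0 fE eta0; set eps := eta / _ => hphi.
have eps0 : 0 < eps by rewrite divr_gt0// mulr_gt0//; lra.
have Mu : 2 * M * eps <= eta / 4.
  have -> : eta / 4 = 2 * (M + 1) * eps by rewrite /eps; field; lra.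
  by rewrite ler_wpM2r ?(ltW eps0)//; lra.
(* the points of [E] in a ball of diameter less than [r] satisfy the Lipschitz
   estimate pairwise *)
pose K i : set R := phi @^-1` (E `&` [set x | `|x - e i| <= r / 3]).
have cK i : closed (K i).
  apply: (closed_curve_preimage hphi); apply: closedI => //.
  have -> : [set x | `|x - e i| <= r / 3] = closed_ball (e i) (r / 3).
    by rewrite closed_ballE ?divr_gt0//; apply/seteqP; split=> x /=; rewrite /closed_ball_ /= distrC.
  exact: closed_ball_closed.
have W0 : 0 <= `|v| + eps by rewrite addr_ge0// ltW.
have hM i s t : K i s -> K i t ->
    `|(f \o phi) s - (f \o phi) t| <= M * (`|v| + eps) * `|s - t|.
  move=> [Es ds] [Et dt]; apply: le_trans (fE _ _ Et _) _.
    have := ler_distD (e i) (phi s) (phi t); move: ds dt => /= ds dt.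
    by rewrite [`|e i - _|]distrC; lra.
  by rewrite -mulrA ler_wpM2l//; exact: curve_lipschitz hphi _ _.
have eta4 : 0 < eta / 4 by lra.
have : (@lebesgue_measure R).-negligible (\bigcup_i
    ([set t | K i t /\ ~ almost_diff_within (f \o phi) (K i) (eta / 4) t] `|`
     [set t | K i t /\ ~ density_point (K i) t])).
  apply: negligible_bigcup => i; apply: negligibleU.
    exact: rademacher_within rnp (mulr_ge0 M0 W0) (cK i) (@hM i) eta4.
  exact: negligible_nondensity (closed_measurable (cK i)).
apply: negligibleS => t [Et nt].
have r3 : 0 < r / 3 by lra.
have [i ei] := dense_near (phi t) edense r3; exists i => //.
have Kt : K i t by split=> //=; rewrite distrC ltW.
apply: contrapT => /not_orP[/not_andP[//|/contrapT ad]].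
move=> /not_andP[//|/contrapT dt]; apply: nt.
have [y [d1 [d10 hd1]]] := ad.
have eta4' : 0 <= M * `|v| + `|y| by rewrite addr_ge0// mulr_ge0.
have [kappa k01] := small_multiple eta4' eta4; rewrite mulrC => kC.
have /andP[k0 k1] := k01.
have [d2 d20 hd2] := density_point_near (closed_measurable (cK i)) dt k01.
pose W := 2 * eps + `|v| + 1; have Wgt0 : 0 < W by rewrite /W; have := normr_ge0 v; lra.
exists y, (Num.min (d1 / 2) (Num.min d2 (r / W))); split.
  by rewrite !lt_min !divr_gt0// d20.
move=> s; rewrite !lt_min => /and3P[s1 s2 s3].
have [->|sn0] := eqVneq s 0.
  by rewrite !scale0r addr0 subrr subr0 !normr0 mulr0.
have sp : 0 < `|s| by rewrite normr_gt0.
have [|s' ss' Ks'] := hd2 s; first by rewrite sp.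
have ns' : `|s'| <= 2 * `|s|.
  have := ler_normD (s' - s) s; rewrite subrK.
  have : kappa * `|s| <= `|s| by rewrite ler_piMl.
  by lra.
have hs1 := hd1 s' ltac:(lra) Ks'.
have st := curve_step hphi s s' t.
have h1 : eps * `|s'| <= 2 * eps * `|s|.
  have -> : 2 * eps * `|s| = eps * (2 * `|s|) by ring.
  by rewrite ler_wpM2l// ltW.
have h2 : `|s' - s| * `|v| <= kappa * `|v| * `|s|.
  by rewrite mulrAC ler_wpM2r.
have h2' : kappa * `|v| * `|s| <= `|v| * `|s|.
  by rewrite ler_wpM2r// ler_piMl.
have stepr : `|phi t + s *: v - phi (t + s')| < r.
  apply: le_lt_trans st _; move: s3; rewrite ltr_pdivlMr// /W => s3.
  have e1 : `|s| * (2 * eps + `|v| + 1) = 2 * eps * `|s| + `|v| * `|s| + `|s| by ring.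
  by lra.
have hf := fE _ _ Ks'.1 stepr.
have hf2 : M * `|phi t + s *: v - phi (t + s')| <=
    M * (2 * eps * `|s| + kappa * `|v| * `|s|).
  by rewrite ler_wpM2l//; lra.
have -> : f (phi t + s *: v) - f (phi t) - s *: y =
    (f (phi t + s *: v) - f (phi (t + s'))) +
    (f (phi (t + s')) - f (phi t) - s' *: y) + (s' - s) *: y.
  by rewrite scalerBl -[RHS]addrA subrKA [RHS]addrA subrKA.
apply: le_trans (ler_normD _ _) _.
have n1 := ler_normD (f (phi t + s *: v) - f (phi (t + s')))
  (f (phi (t + s')) - f (phi t) - s' *: y).
have n2 : `|(s' - s) *: y| <= kappa * `|y| * `|s|.
  by rewrite normrZ mulrAC ler_wpM2r.
have n3 : eta / 4 * `|s'| <= eta / 2 * `|s|.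
  apply: (@le_trans _ _ (eta / 4 * (2 * `|s|))); first by rewrite ler_wpM2l// ltW.
  by rewrite le_eqVlt; apply/orP; left; apply/eqP; field.
have n4 : (2 * M * eps + kappa * (M * `|v| + `|y|)) * `|s| <= eta / 2 * `|s|.
  by rewrite ler_wpM2r//; lra.
have e4 : (2 * M * eps + kappa * (M * `|v| + `|y|)) * `|s| =
  M * (2 * eps * `|s| + kappa * `|v| * `|s|) + kappa * `|y| * `|s| by ring.
have e5 : eta * `|s| = eta / 2 * `|s| + eta / 2 * `|s| by field.
have hs1' : `|f (phi (t + s')) - f (phi t) - s' *: y| <= eta / 4 * `|s'| by [].
by lra.
Qed.

End nondifferentiability.

(** * Lipschitz sets and uniform differentiability *)

Section lipset.
Context (R : realType) (X Y : completeNormedModType R) (f : X -> Y) (G : set X).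
Hypothesis fG : forall x, G x -> {for x, continuous f}.

Definition lipset (r M : R) : set X :=
  [set x | forall y, `|y - x| < r -> G y /\ `|f y - f x| <= M * `|y - x|].

(** The restriction to [`|t *: u| < r] keeps [x + t *: u] in [G], where [f] is
continuous; so this set is closed. *)
Definition uniform_diff (r M : R) (u : X) (z : Y) (eta d : R) : set X :=
  [set x | lipset r M x /\ forall t, `|t| < d -> `|t *: u| < r ->
    `|f (x + t *: u) - f x - t *: z| <= eta * `|t|].

Lemma continuous_near (x : X) (e : R) : G x -> 0 < e ->
  exists2 d, 0 < d & forall y, `|y - x| < d -> `|f y - f x| <= e.
Proof.
move=> /fG/cvgrPdist_le h e0; have /nbhs_ballP[d /= d0 hd] := h e e0.
exists d => // y yx; rewrite distrC; apply: hd.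
by rewrite -ball_normE /= distrC.
Qed.

Lemma lipset_sub r M x : 0 < r -> lipset r M x -> G x.
Proof. by move=> r0 hx; have [] := hx x; rewrite ?subrr ?normr0. Qed.

Lemma lipset_shift r M x w : lipset r M x -> `|w| < r -> G (x + w).
Proof. by move=> hx wr; have [] := hx (x + w); rewrite // addrC addKr. Qed.

Lemma closure_near (A : set X) (x : X) : closure A x -> forall e : R, 0 < e ->
  exists2 y, A y & `|y - x| < e.
Proof.
move=> cx e e0; have [y [Ay]] := cx _ (nbhsx_ballx x _ e0).
by rewrite -ball_normE /= distrC; exists y.
Qed.

Lemma closed_lipset r M : 0 < r -> 0 <= M -> closed (lipset r M).
Proof.
move=> r0 M0 x cx.
have Gy y : `|y - x| < r -> G y.
  move=> yx; have e0 : 0 < r - `|y - x| by rewrite subr_gt0.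
  have [z zl zx] := closure_near cx e0; apply: (proj1 (zl y _)).
  by have := ler_distD x y z; rewrite [`|x - z|]distrC; lra.
have Gx : G x by apply: Gy; rewrite subrr normr0.
move=> y yx; split; first exact: Gy.
apply/ler_addgt0Pr => e e0.
have e2 : 0 < e / 2 by lra.
have [d d0 hd] := continuous_near Gx e2.
have m0 : 0 < Num.min d (Num.min (r - `|y - x|) (e / (2 * (M + 1)))).
  by rewrite !lt_min d0 subr_gt0 yx divr_gt0// mulr_gt0//; lra.
have [z zl] := closure_near cx m0; rewrite !lt_min => /and3P[zd zr ze].
have := ler_distD x y z; rewrite [`|x - z|]distrC => yz.
have [|_ hz] := zl y; first by lra.
have fz := hd z zd.
have h1 := ler_distD (f z) (f y) (f x).
have h2 : M * `|y - z| <= M * (`|y - x| + `|z - x|) by rewrite ler_wpM2l.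
have h3 : M * `|z - x| <= e / 2.
  apply: (@le_trans _ _ ((M + 1) * (e / (2 * (M + 1))))).
    by apply: ler_pM => //; [lra|exact: ltW].
  by rewrite le_eqVlt; apply/orP; left; apply/eqP; field; lra.
by rewrite mulrDr in h2; lra.
Qed.

Lemma closed_uniform_diff r M u z eta d : 0 < r -> 0 <= M -> 0 <= eta ->
  closed (uniform_diff r M u z eta d).
Proof.
move=> r0 M0 eta0 x cx.
have xl : lipset r M x.
  by apply: closed_lipset => //; apply: closure_subset cx => y [].
split=> // t td tr.
apply/ler_addgt0Pr => e e0; have e2 : 0 < e / 2 by lra.
have [d1 d10 h1] := continuous_near (lipset_sub r0 xl) e2.
have [d2 d20 h2] := continuous_near (lipset_shift xl tr) e2.
have m0 : 0 < Num.min d1 d2 by rewrite lt_min d10.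
have [y [_ /(_ t td tr) hy]] := closure_near cx m0; rewrite lt_min => /andP[y1 y2].
have := h1 y y1; have := h2 (y + t *: u).
rewrite opprD addrACA subrr addr0 => /(_ y2) k2 k1.
have -> : f (x + t *: u) - f x - t *: z =
  (f (y + t *: u) - f y - t *: z) - (f (y + t *: u) - f (x + t *: u)) +
  (f y - f x).
  rewrite opprB; set a := f (y + _); set b := f (x + _).
  by rewrite [a - f y - t *: z + _]addrAC [RHS]addrAC
    [a - f y + _]addrC !subrKA.
apply: le_trans (ler_normD _ _) _.
have := ler_normB (f (y + t *: u) - f y - t *: z) (f (y + t *: u) - f (x + t *: u)).
by lra.
Qed.

End lipset.

(** * All directions from a sequence with dense span *)

Section ideal_calculus.
Context (R : realType) (X : normedModType R) (v : nat -> X).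
Hypothesis vdense : dense (linear_span v).

Lemma linear_span_ind (P : X -> Prop) :
  P 0 -> (forall n, P (v n)) -> (forall s u, s != 0 -> P u -> P (s *: u)) ->
  (forall u w, P u -> P w -> P (u + w)) ->
  (forall u, (forall c : R, 0 < c -> exists2 u', `|u - u'| <= c & P u') -> P u) ->
  forall u, P u.
Proof.
move=> P0 Pv Ps Pa Pl u; apply: Pl => c c0.
have [|w [uw [n [a wE]]]] := vdense _ (ball_open u c).
  by exists u; exact: ballxx.
exists w; first by move: uw; rewrite -ball_normE => /ltW.
rewrite wE; elim/big_ind: _ => // i _.
by have [->|a0] := eqVneq (a i) 0; [rewrite scale0r|exact: Ps].
Qed.

(** In the case of sums, porosity is needed for other closed sets than [E], whence
an induction for all closed sets at once. *)
Lemma porous_ideal (E : set X) u c : closed E -> 0 < c ->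
  tildeA_ideal v (porous E u c).
Proof.
move=> cE c0; move: E cE c c0; move: u; apply: linear_span_ind.
- move=> E _ c c0; rewrite porous0//; exists (fun=> porous setT 0 1); split=> [k|//].
  exists 0%N, (1 / 2); split; first by rewrite divr_gt0.
  rewrite porous0//; split; first exact: sigma_algebra0.
  by move=> phi _; rewrite preimage_set0; exact: negligible_set0.
- move=> n E cE c c0; apply: (tildeA_ideal_veps (n := n) (e := c / 2)).
    by rewrite divr_gt0.
  exact: porous_tildeA_veps.
- move=> s u s0 h E cE c c0; apply: tildeA_ideal_sub (porous_scale s0) _.
  by apply: h => //; rewrite divr_gt0// normr_gt0.
- move=> u w hu hw E cE c c0; have c4 : 0 < c / 4 by rewrite divr_gt0.
  apply: tildeA_ideal_sub (porous_add c0) _; apply: tildeA_idealU; first exact: hw.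
  by apply: tildeA_ideal_bigcup => j; apply: hu => //; exact: closed_nonporous.
- move=> u h E cE c c0; have c2 : 0 < c / 2 by rewrite divr_gt0.
  have [u' uu' hu'] := h _ c2.
  by apply: tildeA_ideal_sub (porous_approx c0 uu') _; exact: hu'.
Qed.

End ideal_calculus.

Section lipset_calculus.
Context (R : realType) (X Y : completeNormedModType R) (f : X -> Y) (G : set X).
Hypothesis fG : forall x, G x -> {for x, continuous f}.
Variables (r M : R).
Hypotheses (r0 : 0 < r) (M0 : 0 <= M).
Implicit Types (u : X) (z : Y) (theta c d : R).
Local Notation E := (lipset f G r M).

(** Both values of [f] are compared with its value at a point of [E] within
[2 * c * `|t|] of [x + t *: u]. *)
Lemma lipset_near u c d x : 0 < c -> 0 < d -> nonporous E u c d x ->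
  exists2 d', 0 < d' & forall t w, `|t| < d' -> `|u - w| <= 1 ->
    `|f (x + t *: u) - f (x + t *: w)| <= M * (`|u - w| + 4 * c) * `|t|.
Proof.
move=> c0 d0 [Ex xd]; have K0 : 0 < 1 + 2 * c by lra.
exists (Num.min d (r / (1 + 2 * c))); first by rewrite lt_min d0 divr_gt0.
move=> t w; rewrite lt_min => /andP[td tr] uw.
have [->|t0] := eqVneq t 0; first by rewrite !scale0r subrr !normr0 mulr0.
have tp : 0 < `|t| by rewrite normr_gt0.
have [||y Ey xy] := xd t (2 * c); first by rewrite tp.
  by lra.
rewrite ltr_pdivlMr// in tr.
have uwt : `|t *: u - t *: w| = `|u - w| * `|t| by rewrite -scalerBr normrZ mulrC.
have h1 : `|u - w| * `|t| <= `|t| by rewrite ler_piMl.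
have h2 : `|x + t *: w - y| <= (`|u - w| + 2 * c) * `|t|.
  have -> : x + t *: w - y = (x + t *: u - y) - (t *: u - t *: w).
    by rewrite opprB [x + t *: u - y]addrAC -[RHS]addrA [t *: u + _]addrC subrK
      addrAC.
  apply: le_trans (ler_normB _ _) _; rewrite uwt mulrDl; lra.
have e1 : `|t| * (1 + 2 * c) = `|t| + 2 * c * `|t| by ring.
have [|_ k1] := Ey (x + t *: u); first by lra.
have [|_ k2] := Ey (x + t *: w); first by rewrite mulrDl in h2; lra.
have := ler_distD (f y) (f (x + t *: u)) (f (x + t *: w)).
rewrite [`|f y - _|]distrC => h.
have m1 : M * `|x + t *: u - y| <= M * (2 * c * `|t|) by rewrite ler_wpM2l.
have m2 : M * `|x + t *: w - y| <= M * ((`|u - w| + 2 * c) * `|t|) by rewrite ler_wpM2l.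
have -> : M * (`|u - w| + 4 * c) * `|t| =
  M * (2 * c * `|t|) + M * ((`|u - w| + 2 * c) * `|t|) by ring.
by lra.
Qed.

(** The increment of [f] from [x + t *: u1] to [x + t *: (u1 + u2)] is compared
with the one from [y] to [y + t *: u2], where [y] is close to [x + t *: u1] and
has uniform approximate derivative [z]. A point of [E] close to
[x + t *: (u1 + u2)] relates the end points. *)
Lemma increment_add u1 u2 z theta c d d1 d2 x : 0 < c -> 0 < d -> 0 < d1 ->
  0 < d2 -> 0 <= theta -> nonporous E (u1 + u2) c d1 x ->
  nonporous (uniform_diff f G r M u2 z theta d) u1 c d2 x ->
  exists2 d', 0 < d' & forall t, `|t| < d' ->
    `|f (x + t *: (u1 + u2)) - f (x + t *: u1) - t *: z| <=
      (8 * M * c + theta) * `|t|.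
Proof.
move=> c0 d0 d10 d20 th0 [Ex x1] [_ x2].
have K1 : 0 < `|u2| + 1 by rewrite ltr_wpDl.
have K2 : 0 < 4 * c by lra.
exists (Num.min (Num.min d d1) (Num.min d2 (Num.min (r / (`|u2| + 1)) (r / (4 * c))))).
  by rewrite !lt_min d0 d10 d20 !divr_gt0.
move=> t; rewrite !lt_min => /andP[/andP[td t1] /and3P[t2 tr tc]].
have [->|t0] := eqVneq t 0.
  by rewrite !scale0r subrr subr0 !normr0 mulr0.
have tp : 0 < `|t| by rewrite normr_gt0.
rewrite ltr_pdivlMr// in tr; rewrite ltr_pdivlMr// in tc.
have c2 : c < 2 * c by lra.
have [|y' Ey' xy'] := x1 t (2 * c) _ c2; first by rewrite tp.
have [|y [Ey hy] xy] := x2 t (2 * c) _ c2; first by rewrite tp.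
have tu2 : `|t *: u2| < r by rewrite normrZ; rewrite mulrDr mulr1 in tr; lra.
have hyt := hy t td tu2.
have yy' : `|y + t *: u2 - y'| <= 4 * c * `|t|.
  have -> : y + t *: u2 - y' = (x + t *: (u1 + u2) - y') - (x + t *: u1 - y).
    by rewrite scalerDr opprB [x + (_ + _)]addrA [RHS]addrC -[x + _ + _ - y']addrA subrKA
      addrA.
  apply: le_trans (ler_normB _ _) _; lra.
have tc' : 2 * c * `|t| <= 4 * c * `|t| by rewrite ler_wpM2r//; lra.
have tcc : `|t| * (4 * c) = 4 * c * `|t| by ring.
have [|_ k1] := Ey' (x + t *: (u1 + u2)); first by lra.
have [|_ k2] := Ey' (y + t *: u2); first by lra.
have [|_ k3] := Ey (x + t *: u1); first by lra.
have -> : f (x + t *: (u1 + u2)) - f (x + t *: u1) - t *: z =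
  (f (x + t *: (u1 + u2)) - f y') - (f (y + t *: u2) - f y') +
  (f (y + t *: u2) - f y - t *: z) - (f (x + t *: u1) - f y).
  by rewrite !opprB subrKA -[f (y + t *: u2) - f y - t *: z]addrA subrKA
    [- f y - _]addrC [f _ + (_ - f y)]addrA subrKA addrAC.
have n1 := ler_normB (f (x + t *: (u1 + u2)) - f y') (f (y + t *: u2) - f y').
have n2 := ler_normD ((f (x + t *: (u1 + u2)) - f y') - (f (y + t *: u2) - f y'))
  (f (y + t *: u2) - f y - t *: z).
apply: le_trans (ler_normB _ _) _.
have m1 : M * `|x + t *: (u1 + u2) - y'| <= M * (2 * c * `|t|) by rewrite ler_wpM2l.
have m2 : M * `|y + t *: u2 - y'| <= M * (4 * c * `|t|) by rewrite ler_wpM2l.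
have m3 : M * `|x + t *: u1 - y| <= M * (2 * c * `|t|) by rewrite ler_wpM2l.
have -> : (8 * M * c + theta) * `|t| = M * (2 * c * `|t|) + M * (4 * c * `|t|) +
  M * (2 * c * `|t|) + theta * `|t| by ring.
by lra.
Qed.

End lipset_calculus.

Section nondiff_ideal.
Context (R : realType) (X Y : completeNormedModType R) (f : X -> Y) (G : set X).
Hypothesis fG : forall x, G x -> {for x, continuous f}.
Variables (r M : R).
Hypotheses (r0 : 0 < r) (M0 : 0 <= M).
Variable e : nat -> X.
Hypothesis edense : dense (range e).
Implicit Types (u : X) (z : Y) (eta c d s t : R).
Local Notation E := (lipset f G r M).
Local Notation UD := (uniform_diff f G r M).

(** Countably many vectors among which approximate derivatives can be found. The
step [j.+2%:R^-1] is strictly smaller than the bound [j.+1%:R^-1] used for the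
scale of uniformity. *)
Definition quotient (u : X) (i j : nat) : Y :=
  j.+2%:R *: (f (e i + j.+2%:R^-1 *: u) - f (e i)).

Definition nondiff (u : X) (eta : R) : set X :=
  [set x | E x /\ ~ almost_diff f u eta x].

(** A Borel substitute for [nondiff u eta], which it contains; it is itself
contained in [nondiff u (eta / 3)]. *)
Definition borel_nondiff (u : X) (eta : R) : set X :=
  E `\` \bigcup_i \bigcup_j UD u (quotient u i j) eta j.+1%:R^-1.

Lemma borel_borel_nondiff u eta : 0 <= eta ->
  <<s @open X >> (borel_nondiff u eta).
Proof.
move=> eta0; apply: borel_setD; first by apply: borel_closed; exact: closed_lipset.
by do 2!(apply: borel_bigcup => ?); apply: borel_closed; exact: closed_uniform_diff.
Qed.

Lemma uniform_diff_almost_diff u z eta d : 0 < d ->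
  UD u z eta d `<=` almost_diff f u eta.
Proof.
move=> d0 x [_ hx]; have K0 : 0 < `|u| + 1 by rewrite ltr_wpDl.
exists z, (Num.min d (r / (`|u| + 1))); split; first by rewrite lt_min d0 divr_gt0.
move=> t; rewrite lt_min => /andP[td]; rewrite ltr_pdivlMr// mulrDr mulr1 => tr.
by apply: hx => //; rewrite normrZ; have := normr_ge0 t; lra.
Qed.

Lemma nondiff_sub u eta : nondiff u eta `<=` borel_nondiff u eta.
Proof.
move=> x [Ex nx]; split=> // -[i _ [j _ xij]]; apply: nx.
by apply: uniform_diff_almost_diff xij; rewrite invr_gt0 ltr0n.
Qed.

(** By continuity of [f], a difference quotient at [x] is approximated by the
quotient with the same step at a nearby point [e i]. *)
Lemma almost_diff_uniform_diff u eta x : E x -> 0 < eta -> almost_diff f u eta x ->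
  exists i j, UD u (quotient u i j) (3 * eta) j.+1%:R^-1 x.
Proof.
move=> Ex eta0 [z [d [d0 hd]]]; have K0 : 0 < `|u| + 1 by rewrite ltr_wpDl.
have m0 : 0 < Num.min d (r / (`|u| + 1)) by rewrite lt_min d0 divr_gt0.
have [j] := inv_small m0; rewrite lt_min => /andP[jd].
rewrite ltr_pdivlMr// mulrDr mulr1 => jr.
pose tau : R := j.+2%:R^-1.
have tau0 : 0 < tau by rewrite invr_gt0 ltr0n.
have tauj : tau < j.+1%:R^-1 by rewrite ltf_pV2 ?posrE ?ltr0n// ltr_nat.
have tauN : `|tau| = tau by rewrite gtr0_norm.
have tur : `|tau *: u| < r.
  rewrite normrZ tauN; apply: le_lt_trans jr.
  by rewrite ler_wpDr ?invr_ge0 ?ler0n// ler_wpM2r// ltW.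
have e2 : 0 < eta * tau / 2 by rewrite divr_gt0// mulr_gt0.
have [d1 d10 h1] := continuous_near fG (lipset_sub r0 Ex) e2.
have [d2 d20 h2] := continuous_near fG (lipset_shift Ex tur) e2.
have [i ei] : exists i, `|e i - x| < Num.min d1 d2.
  by apply: dense_near => //; rewrite lt_min d10.
move: ei; rewrite lt_min => /andP[ei1 ei2].
have k1 := h1 _ ei1; have := h2 (e i + tau *: u).
rewrite opprD addrACA subrr addr0 => /(_ ei2) k2.
have := hd tau; rewrite tauN => /(_ (lt_trans tauj jd)) k3.
exists i, j; split=> // t tj tr.
have td : `|t| < d by exact: lt_trans tj jd.
have k4 := hd t td.
have qz : `|z - quotient u i j| <= 2 * eta.
  have -> : z - quotient u i j = - (tau^-1 *: ((f (e i + tau *: u) - f (x + tau *: u)) -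
      (f (e i) - f x) + (f (x + tau *: u) - f x - tau *: z))).
    rewrite /quotient -/tau -[j.+2%:R]invrK -/tau.
    have -> : f (e i + tau *: u) - f (x + tau *: u) - (f (e i) - f x) +
        (f (x + tau *: u) - f x - tau *: z) = f (e i + tau *: u) - f (e i) - tau *: z.
      by rewrite opprB addrA [f _ - f _ + _ + _]addrAC !subrKA.
    by rewrite [in RHS]scalerBr scalerA mulVf ?gt_eqF// scale1r opprB.
  rewrite normrN normrZ normfV tauN mulrC ler_pdivrMr//.
  apply: le_trans (ler_normD _ _) _.
  have := ler_normB (f (e i + tau *: u) - f (x + tau *: u)) (f (e i) - f x).
  by lra.
have -> : f (x + t *: u) - f x - t *: quotient u i j =
  (f (x + t *: u) - f x - t *: z) + t *: (z - quotient u i j).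
  by rewrite scalerBr addrA subrK.
apply: le_trans (ler_normD _ _) _; rewrite normrZ.
have : `|t| * `|z - quotient u i j| <= `|t| * (2 * eta) by rewrite ler_wpM2l.
by lra.
Qed.

Lemma borel_nondiff_sub u eta : 0 < eta ->
  borel_nondiff u (3 * eta) `<=` nondiff u eta.
Proof.
move=> eta0 x [Ex nx]; split=> // /(almost_diff_uniform_diff Ex eta0)[i [j h]].
by apply: nx; exists i => //; exists j.
Qed.

Lemma nondiff_scale u s eta : s != 0 ->
  nondiff (s *: u) eta `<=` nondiff u (eta / `|s|).
Proof.
move=> s0 x [Ex nx]; split=> // -[z [d [d0 hd]]]; apply: nx.
have s1 : 0 < `|s| by rewrite normr_gt0.
exists (s *: z), (d / `|s|); split; first by rewrite divr_gt0.
move=> t td; have := hd (t * s); rewrite normrM -ltr_pdivlMr// => /(_ td).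
rewrite -!scalerA.
by have -> : eta / `|s| * (`|t| * `|s|) = eta * `|t| by field; rewrite gt_eqF.
Qed.

Lemma almost_diff_approx u u' eta x c : 0 < c <= 1 -> 5 * M * c <= eta / 2 ->
  `|u - u'| <= c -> E x -> ~ porous E u c x ->
  almost_diff f u' (eta / 2) x -> almost_diff f u eta x.
Proof.
move=> /andP[c0 c1] cM uu' Ex px [z [d [d0 hd]]].
have [d1 d10 xd1] := not_porous Ex px.
have [d2 d20 hd2] := lipset_near r0 M0 c0 d10 xd1.
exists z, (Num.min d d2); split; first by rewrite lt_min d0.
move=> t; rewrite lt_min => /andP[td td2].
have h1 := hd t td; have := hd2 t u' td2 (le_trans uu' c1).
have h3 : M * (`|u - u'| + 4 * c) <= eta / 2.
  apply: le_trans cM; have -> : 5 * M * c = M * (c + 4 * c) by ring.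
  by rewrite ler_wpM2l// lerD2r.
have h4 := ler_wpM2r (normr_ge0 t) h3 => h2.
have -> : f (x + t *: u) - f x - t *: z = (f (x + t *: u) - f (x + t *: u')) +
  (f (x + t *: u') - f x - t *: z) by rewrite [RHS]addrA subrKA.
apply: le_trans (ler_normD _ _) _.
have -> : eta * `|t| = eta / 2 * `|t| + eta / 2 * `|t| by field.
by lra.
Qed.

Lemma nondiff_approx u u' eta c : 0 < c <= 1 -> 5 * M * c <= eta / 2 ->
  `|u - u'| <= c -> nondiff u eta `<=` porous E u c `|` nondiff u' (eta / 2).
Proof.
move=> c01 cM uu' x [Ex nx]; have [|px] := pselect (porous E u c x); first by left.
by right; split=> // ad; apply: nx; exact: almost_diff_approx cM uu' Ex px ad.
Qed.

(** Off the sets on the right, increments in the direction [u1] at [x] and in the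
direction [u2] at nearby points add up, by [increment_add]. *)
Lemma nondiff_add u1 u2 eta c : 0 < eta -> 0 < c -> 8 * M * c <= eta / 2 ->
  nondiff (u1 + u2) eta `<=` (nondiff u1 (eta / 4) `|` nondiff u2 (eta / 12)) `|`
    (porous E (u1 + u2) c `|` \bigcup_i \bigcup_j
      porous (UD u2 (quotient u2 i j) (eta / 4) j.+1%:R^-1) u1 c).
Proof.
move=> eta0 c0 cM x [Ex nx].
have [[z1 [d [d0 hd]]]|h] := pselect (almost_diff f u1 (eta / 4) x); last first.
  by left; left; split.
have [ad2|h] := pselect (almost_diff f u2 (eta / 12) x); last first.
  by left; right; split.
right; have [|px] := pselect (porous E (u1 + u2) c x); first by left.
right; have [d1 d10 xd1] := not_porous Ex px.
have [i [j]] := almost_diff_uniform_diff Ex (divr_gt0 eta0 (ltr0n _ 12)) ad2.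
have -> : 3 * (eta / 12) = eta / 4 by field.
move=> xij; exists i => //; exists j => //; apply: contrapT => pij; apply: nx.
have [d2 d20 xd2] := not_porous xij pij.
have j0 : 0 < j.+1%:R^-1 :> R by rewrite invr_gt0 ltr0n.
have eta4 : 0 <= eta / 4 by lra.
have [d3 d30 hd3] := increment_add r0 M0 c0 j0 d10 d20 eta4 xd1 xd2.
exists (z1 + quotient u2 i j), (Num.min d d3); split; first by rewrite lt_min d0.
move=> t; rewrite lt_min => /andP[td td3].
have h1 := hd t td; have h2 := hd3 t td3.
have -> : f (x + t *: (u1 + u2)) - f x - t *: (z1 + quotient u2 i j) =
  (f (x + t *: (u1 + u2)) - f (x + t *: u1) - t *: quotient u2 i j) +
  (f (x + t *: u1) - f x - t *: z1).
  by rewrite [t *: (z1 + _)]scalerDr opprD [RHS]addrACA subrKA [- (t *: z1) - _]addrC.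
apply: le_trans (ler_normD _ _) _.
have h3 : (8 * M * c + eta / 4) * `|t| <= (eta / 2 + eta / 4) * `|t|.
  by rewrite ler_wpM2r// lerD2r.
have -> : eta * `|t| = (eta / 2 + eta / 4) * `|t| + eta / 4 * `|t| by field.
by lra.
Qed.

(** For the directions [v n] this is the estimate along curves; all other
directions are reached by linear combinations and limits. *)
Lemma nondiff_ideal (v : nat -> X) u eta : separable X ->
  radon_nikodym_property Y -> dense (linear_span v) -> 0 < eta ->
  tildeA_ideal v (nondiff u eta).
Proof.
move=> sX rnp vd eta0; have M1 : 0 < M + 1 by rewrite ltr_wpDl.
move: eta eta0; move: u.
have cE : closed E by exact: closed_lipset.
have cUD u z eta d : 0 <= eta -> closed (UD u z eta d) by exact: closed_uniform_diff.
apply: (linear_span_ind vd).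
- move=> eta eta0; apply: tildeA_ideal_sub (porous_ideal (E := set0) (c := 1) vd 0 closed0 ltr01).
  move=> x [Ex nx]; exfalso; apply: nx; exists 0, 1; split=> // t _.
  by rewrite !scaler0 addr0 subrr subr0 normr0 mulr_ge0// ltW.
- move=> n eta eta0; apply: tildeA_ideal_sub (@nondiff_sub _ _) _.
  have eta3 : 0 < eta / 3 by lra.
  apply: (tildeA_ideal_veps (n := n) (e := eta / 3 / (8 * (M + 1)))).
    by rewrite divr_gt0// mulr_gt0.
  split; first by apply: borel_borel_nondiff; exact: ltW.
  move=> phi hphi; have := negligible_not_almost_diff sX rnp cE M0 r0 _ eta3 hphi.
  have fE x y : E x -> `|y - x| < r -> `|f y - f x| <= M * `|y - x|.
    by move=> Ex yx; have [] := Ex y yx.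
  move=> /(_ f fE); apply: negligibleS => t /= ht.
  by apply: borel_nondiff_sub => //; rewrite (_ : 3 * (eta / 3) = eta)//; field.
- move=> s u s0 h eta eta0; apply: tildeA_ideal_sub (nondiff_scale s0) _.
  by apply: h; rewrite divr_gt0// normr_gt0.
- move=> u1 u2 h1 h2 eta eta0.
  have [|c /andP[c0 _] cM] := small_multiple (mulr_ge0 (ler0n _ 8) M0) (eta := eta / 2).
    by rewrite divr_gt0.
  apply: tildeA_ideal_sub (nondiff_add eta0 c0 cM) _.
  apply: tildeA_idealU; apply: tildeA_idealU.
  + by apply: h1; lra.
  + by apply: h2; lra.
  + exact: porous_ideal.
  + do 2!(apply: tildeA_ideal_bigcup => ?).
    by apply: porous_ideal => //; apply: cUD; lra.
- move=> u h eta eta0.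
  have [|c c01 cM] := small_multiple (mulr_ge0 (ler0n _ 5) M0) (eta := eta / 2).
    by rewrite divr_gt0.
  have /andP[c0 _] := c01.
  have [u' uu' hu'] := h c c0.
  apply: tildeA_ideal_sub (nondiff_approx c01 cM uu') _.
  by apply: tildeA_idealU; [exact: porous_ideal|apply: hu'; lra].
Qed.

End nondiff_ideal.

(** * Hadamard differentiability *)

Section hadamard.
Context (R : realType) (X Y : completeNormedModType R) (f : X -> Y) (x : X).
Implicit Types (u w : X) (z : Y) (eta c d s t : R).

Lemma almost_diff_unique u z1 z2 eta1 eta2 d1 d2 : 0 < d1 -> 0 < d2 ->
  (forall t, `|t| < d1 -> `|f (x + t *: u) - f x - t *: z1| <= eta1 * `|t|) ->
  (forall t, `|t| < d2 -> `|f (x + t *: u) - f x - t *: z2| <= eta2 * `|t|) ->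
  `|z1 - z2| <= eta1 + eta2.
Proof.
move=> d10 d20 h1 h2; pose t := Num.min d1 d2 / 2.
have m0 : 0 < Num.min d1 d2 by rewrite lt_min d10.
have t0 : 0 < t by rewrite divr_gt0.
have tm : `|t| < Num.min d1 d2.
  by rewrite gtr0_norm// /t ltr_pdivrMr// ltr_pMr// ltr1n.
move: tm; rewrite lt_min => /andP[/h1 k1 /h2 k2]; rewrite gtr0_norm// in k1 k2.
rewrite -(ler_pM2r t0) mulrDl -{1}(gtr0_norm t0) mulrC -normrZ.
have -> : t *: (z1 - z2) = (f (x + t *: u) - f x - t *: z2) -
    (f (x + t *: u) - f x - t *: z1).
  by rewrite scalerBr opprB [RHS]addrC subrKA.
apply: le_trans (ler_normB _ _) _; lra.
Qed.

Definition dir_deriv u z := forall eta, 0 < eta -> exists2 d, 0 < d &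
  forall t, `|t| < d -> `|f (x + t *: u) - f x - t *: z| <= eta * `|t|.

Lemma dir_deriv_ex u : (forall eta, 0 < eta -> almost_diff f u eta x) ->
  exists z, dir_deriv u z.
Proof.
move=> ad; have /choice[z hz] : forall k : nat, exists z, exists2 d, 0 < d &
    forall t, `|t| < d -> `|f (x + t *: u) - f x - t *: z| <= k.+1%:R^-1 * `|t|.
  move=> k; have [|z [d [d0 hd]]] := ad k.+1%:R^-1; first by rewrite invr_gt0 ltr0n.
  by exists z, d.
have zz k l : `|z k - z l| <= k.+1%:R^-1 + l.+1%:R^-1.
  have [d1 d10 h1] := hz k; have [d2 d20 h2] := hz l.
  exact: almost_diff_unique d10 d20 h1 h2.
have inv_le (N n : nat) : (N <= n)%N -> n.+1%:R^-1 <= N.+1%:R^-1 :> R.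
  by move=> Nn; rewrite lef_pV2 ?posrE ?ltr0n// ler_nat.
have [eta eta0|l zl] := cvgn_cauchy (u := z).
  have [N hN] := inv_small (divr_gt0 eta0 (ltr0n _ 2)).
  exists N => n Nn; apply: le_trans (zz _ _) _.
  have := inv_le _ _ Nn; move: hN; set a := N.+1%:R^-1; set b := n.+1%:R^-1; lra.
exists l => eta eta0.
have e2 : 0 < eta / 2 by rewrite divr_gt0.
have [N hN] := inv_small e2; have /cvgn_distP/(_ _ e2)[K hK] := zl.
pose n := maxn N K; have [d d0 hd] := hz n; exists d => // t td.
have h1 := hd t td; have h2 := hK n (leq_maxr _ _).
have -> : f (x + t *: u) - f x - t *: l = (f (x + t *: u) - f x - t *: z n) +
    t *: (z n - l) by rewrite scalerBr subrKA.
apply: le_trans (ler_normD _ _) _; rewrite normrZ.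
have -> : eta * `|t| = eta / 2 * `|t| + `|t| * (eta / 2) by field.
apply: lerD; last by rewrite ler_wpM2l.
apply: le_trans h1 _; rewrite ler_wpM2r//.
by apply: le_trans (inv_le _ _ (leq_maxl N K)) _; exact: ltW.
Qed.

Lemma dir_deriv_dist u w z z' eta d : 0 < d -> dir_deriv u z -> dir_deriv w z' ->
  (forall t, `|t| < d -> `|f (x + t *: u) - f (x + t *: w)| <= eta * `|t|) ->
  `|z - z'| <= eta.
Proof.
move=> d0 hz hz' hd; apply/ler_addgt0Pr => e e0.
have e2 : 0 < e / 2 by rewrite divr_gt0.
have [d1 d10 h1] := hz _ e2; have [d2 d20 h2] := hz' _ e2.
have -> : eta + e = e / 2 + (e / 2 + eta) by field.
have m0 : 0 < Num.min d d2 by rewrite lt_min d0.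
apply: almost_diff_unique d10 m0 h1 _ => t; rewrite lt_min => /andP[td td2].
have -> : f (x + t *: u) - f x - t *: z' = (f (x + t *: u) - f (x + t *: w)) +
  (f (x + t *: w) - f x - t *: z') by rewrite [RHS]addrA subrKA.
apply: le_trans (ler_normD _ _) _.
by have := hd t td; have := h2 t td2; rewrite mulrDl; lra.
Qed.

Lemma dir_deriv_unique u z z' : dir_deriv u z -> dir_deriv u z' -> z = z'.
Proof.
move=> hz hz'; apply/eqP; rewrite -subr_eq0 -normr_le0.
apply: (@dir_deriv_dist u u z z' 0 1) => // t _.
by rewrite subrr normr0 mul0r.
Qed.

Lemma dir_derivZ u z s : dir_deriv u z -> dir_deriv (s *: u) (s *: z).
Proof.
move=> hz eta eta0; have s1 : 0 < `|s| + 1 by rewrite ltr_wpDl.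
have [d d0 hd] := hz _ (divr_gt0 eta0 s1).
exists (d / (`|s| + 1)); first by rewrite divr_gt0.
move=> t; rewrite ltr_pdivlMr// => td; rewrite !scalerA.
have ts : `|t * s| <= `|t| * (`|s| + 1) by rewrite normrM ler_wpM2l// lerDl.
apply: le_trans (hd _ (le_lt_trans ts td)) _.
apply: le_trans (ler_wpM2l _ ts) _; first by rewrite divr_ge0// ltW.
by rewrite le_eqVlt; apply/orP; left; apply/eqP; field; rewrite gt_eqF.
Qed.

(** A linear map which is an almost derivative at [x] locally uniformly in the
direction is a Hadamard derivative, by the near-covering characterization of
compactness. *)
Lemma hadamard_of_local (L : {linear X -> Y}) : continuous L ->
  (forall u eta, 0 < eta -> exists2 d, 0 < d & forall t w, `|t| < d ->
    `|u - w| < d -> `|f (x + t *: w) - f x - t *: L w| <= eta * `|t|) ->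
  hadamard_differentiable f x.
Proof.
move=> cL hL; exists L => q.
have qE t w : t != 0 -> `|L w - q t w| = `|t|^-1 * `|f (x + t *: w) - f x - t *: L w|.
  move=> t0; rewrite distrC -normfV -normrZ /q.
  by rewrite [t^-1 *: (_ - t *: L w)]scalerBr scalerA mulVf// scale1r.
have loc u (eta : R) : 0 < eta -> \forall w \near u & t \near (0 : R)^',
    `|L w - q t w| < eta.
  move=> eta0; have e2 : 0 < eta / 2 by rewrite divr_gt0.
  have [d d0 hd] := hL u _ e2.
  exists (ball u d, [set t | t != 0 /\ `|t| < d]).
    split; first exact: nbhsx_ballx.
    apply/nbhs_ballP; exists d => //= t; rewrite /ball /= sub0r normrN => td t0.
    by split.
  move=> [w t] /= [uw [t0 td]]; move: uw; rewrite -ball_normE /= => uw.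
  rewrite qE// mulrC ltr_pdivrMr ?normr_gt0//.
  apply: le_lt_trans (hd t w td uw) _.
  by rewrite ltr_pM2r ?normr_gt0// ltr_pdivrMr// ltr_pMr// ltr1n.
split=> //.
- move=> v; apply/cvgrPdist_lt => eta eta0.
  have [[A B] /= [Av B0] AB] := loc v eta eta0.
  apply: filterS B0 => t Bt; apply: (AB (v, t)); split=> //=.
  exact: nbhs_singleton.
- move=> C /compact_near_coveringP cC.
  move=> P /uniform_nbhs[Ent [entE sub]].
  move: entE; rewrite -entourage_ballE => -[eta /= eta0 subE].
  have := cC _ ((0 : R)^') (fun t w => `|L w - q t w| < eta) _.
  move=> /(_ _ (fun u _ => loc u eta eta0)); apply: filterS => t Ct.
  by apply: sub => y Cy; apply: subE; rewrite /= -ball_normE; exact: Ct.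
Qed.
End hadamard.

(** * The exceptional set *)

Section exceptional.
Context (R : realType) (X Y : completeNormedModType R) (f : X -> Y) (G : set X).
Hypothesis fG : forall x, G x -> {for x, continuous f}.
Variables (r M : R).
Hypotheses (r0 : 0 < r) (M0 : 0 <= M).
Variable e : nat -> X.
Hypothesis edense : dense (range e).
Implicit Types (u w x : X) (z : Y) (eta c d s t : R).
Local Notation E := (lipset f G r M).
Local Notation UD := (uniform_diff f G r M).

Let inv0 (k : nat) : 0 < k.+1%:R^-1 :> R. Proof. by rewrite invr_gt0 ltr0n. Qed.

(** Only directions from the dense sequence [e] occur, so that this set does not
depend on any sequence of directions. Its three parts ensure respectively that
points of [E] can be found in all directions, that derivatives are additive, and
that they exist. *)
Definition exceptional : set X :=
  (\bigcup_i \bigcup_k porous E (e i) k.+1%:R^-1) `|`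
  ((\bigcup_i \bigcup_l \bigcup_a \bigcup_j \bigcup_m \bigcup_k
      porous (UD (e l) (quotient f e (e l) a j) m.+1%:R^-1 j.+1%:R^-1)
        (e i) k.+1%:R^-1) `|`
   \bigcup_i \bigcup_m borel_nondiff f G r M e (e i) m.+1%:R^-1).

Lemma borel_porous (S : set X) u c : closed S -> <<s @open X >> (porous S u c).
Proof.
move=> cS; apply: borel_setD; first exact: borel_closed.
by apply: borel_bigcup => j; apply: borel_closed; exact: closed_nonporous.
Qed.

Lemma borel_exceptional : <<s @open X >> exceptional.
Proof.
apply: borel_setU; last apply: borel_setU.
- do 2!(apply: borel_bigcup => ?); apply: borel_porous; exact: closed_lipset.
- do 6!(apply: borel_bigcup => ?); apply: borel_porous.
  by apply: closed_uniform_diff => //; exact: ltW.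
- by do 2!(apply: borel_bigcup => ?); apply: borel_borel_nondiff => //; exact: ltW.
Qed.

Lemma exceptional_ideal (v : nat -> X) : separable X ->
  radon_nikodym_property Y -> dense (linear_span v) ->
  tildeA_ideal v exceptional.
Proof.
move=> sX rnp vd; apply: tildeA_idealU; last apply: tildeA_idealU.
- do 2!(apply: tildeA_ideal_bigcup => ?); apply: porous_ideal => //.
  exact: closed_lipset.
- do 6!(apply: tildeA_ideal_bigcup => ?); apply: porous_ideal => //.
  by apply: closed_uniform_diff => //; exact: ltW.
- apply: tildeA_ideal_bigcup => i; apply: tildeA_ideal_bigcup => m.
  have m3 : 0 < m.+1%:R^-1 / 3 :> R by rewrite divr_gt0.
  apply: tildeA_ideal_sub (nondiff_ideal fG r0 M0 edense (e i) sX rnp vd m3).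
  have := borel_nondiff_sub fG r0 edense (u := e i) m3.
  by rewrite [3 * _]mulrC divfK// pnatr_eq0.
Qed.

Section off_exceptional.
Variable x : X.
Hypotheses (Ex : E x) (nx : ~ exceptional x).

Lemma nonporous_off u c : 0 < c -> exists2 d, 0 < d & nonporous E u c d x.
Proof.
move=> c0; apply: not_porous => // px; apply: nx; left.
have c2 : 0 < c / 2 by rewrite divr_gt0.
have [i ei] := dense_near u edense c2; have [k kc] := inv_small c2.
exists i => //; exists k => //; apply/porousP; split=> // d d0 [_ xd].
have /porousP[_ /(_ d d0)] : porous E (e i) (c / 2) x.
  by apply: porous_approx px => //; rewrite distrC ltW.
apply; split=> // t c' td cc'; apply: xd => //; exact: lt_trans cc'.
Qed.

Lemma almost_diff_dense i eta : 0 < eta -> almost_diff f (e i) eta x.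
Proof.
move=> eta0; have [m me] := inv_small eta0.
have : ~ borel_nondiff f G r M e (e i) m.+1%:R^-1 x.
  by move=> h; apply: nx; right; right; exists i => //; exists m.
move=> /not_andP[//|/contrapT[a _ [j _ h]]].
have [z [d [d0 hd]]] := uniform_diff_almost_diff r0 (inv0 j) h.
exists z, d; split=> // t td; apply: le_trans (hd t td) _.
by rewrite ler_wpM2r// ltW.
Qed.

Lemma almost_diff_off u eta : 0 < eta -> almost_diff f u eta x.
Proof.
move=> eta0; have eta2 : 0 < eta / 2 by rewrite divr_gt0.
have [c c01 cM] := small_multiple (mulr_ge0 (ler0n _ 5) M0) eta2.
have /andP[c0 _] := c01.
have [i ei] := dense_near u edense c0.
have [d d0 xd] := nonporous_off u c0.
apply: (almost_diff_approx (G := G) r0 M0 c01 cM (u' := e i)) => //.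
- by rewrite distrC ltW.
- by move=> /porousP[_ h]; exact: (h d d0 xd).
- by apply: almost_diff_dense; rewrite divr_gt0.
Qed.

(** Here [z2] is within [2 * th] of a vector [q] for which [E] contains enough
points, near [x] in the direction [e i], with almost derivative [q] in the
direction [e l]. *)
Lemma dir_deriv_add_dense i l z1 z2 z : dir_deriv f x (e i) z1 ->
  dir_deriv f x (e l) z2 -> dir_deriv f x (e i + e l) z -> z = z1 + z2.
Proof.
move=> h1 h2 h; apply/eqP; rewrite -subr_eq0 -normr_le0.
apply/ler_addgt0Pr => eta eta0; rewrite add0r.
have M1 : 0 < M + 1 by rewrite ltr_wpDl.
have [m me] := inv_small (divr_gt0 eta0 (ltr0n _ 8)).
have [k kc] := inv_small (divr_gt0 eta0 (mulr_gt0 (ltr0n _ 32) M1)).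
pose th : R := m.+1%:R^-1; pose c : R := k.+1%:R^-1.
have th0 : 0 < th by exact: inv0. have c0 : 0 < c by exact: inv0.
have th3 : 0 < th / 3 by rewrite divr_gt0.
have [a [j]] := almost_diff_uniform_diff fG r0 edense Ex th3 (almost_diff_dense l th3).
have -> : 3 * (th / 3) = th by field.
set q := quotient _ _ _ _ _ => xq.
have [d1 d10 xd1] := nonporous_off (e i + e l) c0.
have [d2 d20 xd2] : exists2 d2, 0 < d2 &
    nonporous (UD (e l) q th j.+1%:R^-1) (e i) c d2 x.
  apply: not_porous => // px; apply: nx; right; left.
  by exists i => //; exists l => //; exists a => //; exists j => //; exists m => //; exists k.
have [d3 d30 hd3] := increment_add r0 M0 c0 (inv0 j) d10 d20 (ltW th0) xd1 xd2.
have qz2 : `|z2 - q| <= 2 * th.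
  have [d5 d50 hd5] := h2 _ th0.
  have K0 : 0 < `|e l| + 1 by rewrite ltr_wpDl.
  have m0 : 0 < Num.min j.+1%:R^-1 (r / (`|e l| + 1)).
    by rewrite lt_min inv0 divr_gt0.
  have -> : 2 * th = th + th by ring.
  apply: almost_diff_unique d50 m0 hd5 _ => t; rewrite lt_min => /andP[tj].
  rewrite ltr_pdivlMr// mulrDr mulr1 => tr; apply: xq.2 => //.
  by rewrite normrZ; apply: le_lt_trans tr; rewrite lerDl.
have zq : `|z - (z1 + q)| <= 8 * M * c + th + 2 * (eta / 8).
  have e8 : 0 < eta / 8 by rewrite divr_gt0.
  have [d5 d50 hd5] := h _ e8; have [d6 d60 hd6] := h1 _ e8.
  have m0 : 0 < Num.min d3 d6 by rewrite lt_min d30.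
  have -> : 8 * M * c + th + 2 * (eta / 8) = eta / 8 + (8 * M * c + th + eta / 8) by ring.
  apply: almost_diff_unique d50 m0 hd5 _ => t; rewrite lt_min => /andP[/hd3 k1 /hd6 k2].
  have -> : f (x + t *: (e i + e l)) - f x - t *: (z1 + q) =
    (f (x + t *: (e i + e l)) - f (x + t *: e i) - t *: q) +
    (f (x + t *: e i) - f x - t *: z1).
    by rewrite [t *: (z1 + _)]scalerDr opprD [RHS]addrACA subrKA [- (t *: z1) - _]addrC.
  apply: le_trans (ler_normD _ _) _.
  by rewrite [leRHS]mulrDl; exact: lerD.
have cM : 8 * M * c <= eta / 4.
  apply: (@le_trans _ _ (8 * (M + 1) * (eta / (32 * (M + 1))))).
    apply: ler_pM; rewrite ?(ltW c0) ?mulr_ge0//; first by lra.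
    exact: ltW.
  by rewrite le_eqVlt; apply/orP; left; apply/eqP; field; rewrite gt_eqF.
have -> : z - (z1 + z2) = (z - (z1 + q)) - (z2 - q).
  by rewrite opprB !opprD !addrA subrK.
apply: le_trans (ler_normB _ _) _.
have me' : th <= eta / 8 by exact: ltW.
by lra.
Qed.

Lemma hadamard_off_exceptional : hadamard_differentiable f x.
Proof.
have /choice[L hL] := fun u => dir_deriv_ex (fun eta => @almost_diff_off u eta).
have Ldist u w : `|u - w| <= 1 -> `|L u - L w| <= M * `|u - w|.
  move=> uw; apply/ler_addgt0Pr => eta eta0.
  have M1 : 0 < 4 * (M + 1) by rewrite mulr_gt0// ltr_wpDl.
  pose c := eta / (4 * (M + 1)); have c0 : 0 < c by rewrite divr_gt0.
  have [d d0 xd] := nonporous_off u c0.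
  have [d' d'0 hd'] := lipset_near r0 M0 c0 d0 xd.
  have := dir_deriv_dist d'0 (hL u) (hL w) (fun t td => hd' t w td uw).
  move=> /le_trans; apply; rewrite mulrDr lerD2l.
  have -> : eta = (M + 1) * (4 * c) by rewrite /c; field; rewrite gt_eqF// ltr_wpDl.
  by apply: ler_wpM2r; [rewrite mulr_ge0// ltW|rewrite lerDl].
have LZ s u : L (s *: u) = s *: L u.
  exact: dir_deriv_unique (hL _) (dir_derivZ s (hL u)).
have LD u w : L (u + w) = L u + L w.
  apply/eqP; rewrite -subr_eq0 -normr_le0; apply/ler_addgt0Pr => eta eta0.
  rewrite add0r; have K0 : 0 <= 4 * M + 2 by rewrite addr_ge0// mulr_ge0.
  have [c' /andP[c'0 c'1] cM'] := small_multiple K0 eta0.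
  pose c := c' / 2; have c0 : 0 < c by rewrite divr_gt0.
  have c1 : c <= 1 by rewrite /c ler_pdivrMr// mul1r (le_trans c'1)// ler1n.
  have c21 : 2 * c <= 1 by rewrite /c mulrC divfK ?pnatr_eq0.
  have cM : 4 * M * c <= eta.
    apply: le_trans cM'; rewrite /c; have := mulr_ge0 M0 (ltW c'0).
    by lra.
  have [i ei] := dense_near u edense c0; have [l el] := dense_near w edense c0.
  rewrite distrC in ei; rewrite distrC in el.
  have eil : `|(u + w) - (e i + e l)| <= 2 * c.
    by rewrite opprD addrACA; apply: le_trans (ler_normD _ _) _; lra.
  have k1 := Ldist u (e i) (le_trans (ltW ei) c1).
  have k2 := Ldist w (e l) (le_trans (ltW el) c1).
  have k3 := Ldist _ _ (le_trans eil c21).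
  have a := dir_deriv_add_dense (hL (e i)) (hL (e l)) (hL (e i + e l)).
  have -> : L (u + w) - (L u + L w) = (L (u + w) - L (e i + e l)) -
      (L u - L (e i)) - (L w - L (e l)).
    by rewrite a -[RHS]addrA -opprD [L u - _ + _]addrACA -opprD opprB subrKA.
  apply: le_trans (ler_normB _ _) _.
  have n1 := ler_normB (L (u + w) - L (e i + e l)) (L u - L (e i)).
  have m1 := ler_wpM2l M0 (ltW ei); have m2 := ler_wpM2l M0 (ltW el).
  have m3 := ler_wpM2l M0 eil.
  by lra.
have linL : linear L by move=> s u w; rewrite LD LZ.
pose L' : {linear X -> Y} := HB.pack L (GRing.isLinear.Build R X Y *:%R L linL).
apply: (@hadamard_of_local _ _ _ f x L').
  move=> u; apply/cvgrPdist_le => eta eta0; have M1 : 0 < M + 1 by rewrite ltr_wpDl.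
  apply/nbhs_ballP; exists (Num.min 1 (eta / (M + 1))) => /=.
    by rewrite lt_min ltr01 divr_gt0.
  move=> w; rewrite -ball_normE /= lt_min => /andP[w1]; rewrite ltr_pdivlMr// => we.
  apply: le_trans (Ldist _ _ (ltW w1)) _; apply: le_trans (ltW we).
  by rewrite mulrC ler_wpM2l// lerDl.
move=> u eta eta0; have eta2 : 0 < eta / 2 by rewrite divr_gt0.
have [c /andP[c0 _] cM] := small_multiple (mulr_ge0 (ler0n _ 8) M0) eta2.
have [d1 d10 xd] := nonporous_off u c0.
have [d2 d20 hd2] := lipset_near r0 M0 c0 d10 xd.
have [d3 d30 hd3] := hL u _ (divr_gt0 eta0 (ltr0n _ 4)).
exists (Num.min (Num.min 1 c) (Num.min d2 d3)); first by rewrite !lt_min ltr01 c0 d20.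
move=> t w; rewrite !lt_min => /andP[_ /andP[t2 t3]] /andP[/andP[w1 wc] _].
have k1 := hd2 t w t2 (ltW w1); have k2 := hd3 t t3.
have k3 := Ldist u w (ltW w1).
have -> : f (x + t *: w) - f x - t *: L w = (f (x + t *: u) - f x - t *: L u) -
    (f (x + t *: u) - f (x + t *: w)) + t *: (L u - L w).
  by rewrite scalerBr [RHS]addrAC subrKA opprB [RHS]addrAC [f _ - f x + (_ - f _)]addrC
    subrKA.
apply: le_trans (ler_normD _ _) _; rewrite normrZ.
have n1 := ler_normB (f (x + t *: u) - f x - t *: L u) (f (x + t *: u) - f (x + t *: w)).
have p1 : M * (`|u - w| + 4 * c) * `|t| <= M * (5 * c) * `|t|.
  by rewrite ler_wpM2r// ler_wpM2l//; lra.
have p2 : `|t| * `|L u - L w| <= M * c * `|t|.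
  rewrite mulrC ler_wpM2r//; apply: le_trans k3 _.
  by rewrite ler_wpM2l// ltW.
have p3 : (8 * M * c) * `|t| <= eta / 2 * `|t| by rewrite ler_wpM2r.
have p4 : 0 <= M * c * `|t| by rewrite mulr_ge0// mulr_ge0// ltW.
have p5 : 0 <= eta * `|t| by rewrite mulr_ge0// ltW.
have e1 : M * (5 * c) * `|t| = 5 * (M * c * `|t|) by ring.
have e2 : 8 * M * c * `|t| = 8 * (M * c * `|t|) by ring.
have e3 : eta / 4 * `|t| = (eta * `|t|) / 4 by field.
have e4 : eta / 2 * `|t| = (eta * `|t|) / 2 by field.
by lra.
Qed.

End off_exceptional.
End exceptional.

(** The sets of a countable cover are cut down to [S] and grouped according to
their direction. *)
Lemma tildeA_of_ideal (R : realType) (X : normedModType R) (S : set X) :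
  <<s @open X >> S ->
  (forall v : nat -> X, dense (linear_span v) -> tildeA_ideal v S) -> tildeA S.
Proof.
move=> bS hS v _ vd; have [B [hB SB]] := hS v vd.
have /choice[n /choice[e ne]] := hB.
exists (fun j => \bigcup_k (if n k == j then B k `&` S else set0)).
  move=> j; exists (fun k => if n k == j then B k `&` S else set0), e.
  split=> // k; have [e0 [bB hk]] := ne k; split=> //.
  have [nj|_] := eqVneq (n k) j; split.
  - exact: borel_setI.
  - move=> phi hphi; apply: negligibleS (hk phi _) => [t []//|].
    by rewrite nj.
  - exact: sigma_algebra0.
  - by move=> phi _; rewrite preimage_set0; exact: negligible_set0.
apply/seteqP; split=> [x Sx|x [j _ [k _]]]; last by case: ifP => // _ [].
have [k _ Bx] := SB x Sx; exists (n k) => //; exists k => //.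
by rewrite eqxx.
Qed.

Lemma lipschitz_atP (R : realType) (X Y : normedModType R) (f : X -> Y) (x : X) :
  lipschitz_at f x -> exists (M d : R), [/\ 0 <= M, 0 < d &
    forall y, `|y - x| < d -> `|f y - f x| <= M * `|y - x|].
Proof.
move=> /ereal_inf_lt[_ [V Vx <-] supV].
have /nbhs_ballP[d /= d0 hd] := Vx.
have hV y : `|y - x| < d -> y != x -> V y.
  move=> yx ynx; apply: hd => //; rewrite -ball_normE /= distrC//.
set S := ereal_sup _ in supV.
exists (`|fine S|), d; split=> // y yx.
have [->|ynx] := eqVneq y x; first by rewrite !subrr !normr0 mulr0.
have yx0 : 0 < `|y - x| by rewrite normr_gt0 subr_eq0.
have : ((`|f y - f x| / `|y - x|)%:E <= S)%E.
  by apply: ereal_sup_ubound; exists y => //; exact: hV.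
rewrite -ler_pdivrMr//; case: S supV => //= s _; rewrite lee_fin => /le_trans; apply.
exact: ler_norm.
Qed.

Section main.
Context (R : realType) (X Y : normedModType R) (G : set X) (f : X -> Y).
Hypothesis plf : pointwise_lipschitz G f.

Lemma pointwise_lipschitz_continuous x : G x -> {for x, continuous f}.
Proof.
move=> /plf/lipschitz_atP[M [d [M0 d0 hd]]]; apply/cvgrPdist_le => e e0.
have M1 : 0 < M + 1 by rewrite ltr_wpDl.
apply/nbhs_ballP; exists (Num.min d (e / (M + 1))) => /=.
  by rewrite lt_min d0 divr_gt0.
move=> y; rewrite -ball_normE /= distrC lt_min => /andP[yd].
rewrite ltr_pdivlMr// => ye; rewrite distrC.
apply: le_trans (hd _ yd) _; apply: le_trans (ltW ye).
by rewrite mulrC ler_wpM2l// lerDl.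
Qed.

End main.

Lemma lipset_cover (R : realType) (X Y : completeNormedModType R) (G : set X)
    (f : X -> Y) x : open G -> pointwise_lipschitz G f -> G x ->
  exists n, lipset f G n.+1%:R^-1 n.+1%:R x.
Proof.
move=> oG plf Gx; have [M [d [M0 d0 hd]]] := lipschitz_atP (plf x Gx).
have /nbhs_ballP[d' /= d'0 hd'] : nbhs x G by exact: open_nbhs_nbhs.
have m0 : 0 < Num.min d (Num.min d' (M + 1)^-1).
  by rewrite !lt_min d0 d'0 invr_gt0 ltr_wpDl.
have [n] := inv_small m0; rewrite !lt_min => /and3P[nd nd' nM].
exists n => y yx; split.
  by apply: hd'; rewrite -ball_normE /= distrC; exact: lt_trans nd'.
apply: le_trans (hd y (lt_trans yx nd)) _; rewrite ler_wpM2r//.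
move: nM; rewrite ltf_pV2 ?posrE ?ltr0n// ?ltr_wpDl// => nM.
by apply: le_trans (ltW nM); rewrite lerDl.
Qed.

Theorem corollary3p14 (R : realType) (X Y : completeNormedModType R)
    (G : set X) (f : X -> Y) :
  separable X ->
  radon_nikodym_property Y ->
  open G ->
  pointwise_lipschitz G f ->
  exists2 A : set X, tildeA A &
    forall x, G x -> ~ A x -> hadamard_differentiable f x.
Proof.
move=> sX rnp oG plf; have fG := pointwise_lipschitz_continuous plf.
have [e edense] := separable_seq sX.
have r0 n : 0 < n.+1%:R^-1 :> R by rewrite invr_gt0 ltr0n.
exists (\bigcup_n exceptional f G n.+1%:R^-1 n.+1%:R e).
  apply: tildeA_of_ideal => [|v vd].
    by apply: borel_bigcup => n; exact: borel_exceptional.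
  by apply: tildeA_ideal_bigcup => n; exact: exceptional_ideal.
move=> x Gx nAx; have [n xn] := lipset_cover oG plf Gx.
apply: (hadamard_off_exceptional fG (r0 n) (ler0n _ _) edense xn) => h.
by apply: nAx; exists n.
Qed.
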